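(* Let $E$ be a Polish space, let $(\varphi,\vartheta)$ be a random dynamical system (RDS) on $E$ over $(\Omega,\mathscr F,\mathbb P,(\vartheta_t)_{t\in\mathbb T_1})$ with time set $\mathbb T_2$, and let $\mathcal B$ be an arbitrary family of sets $B\subset E\times\Omega$ (no measurability is assumed). (i) Assume that there exists a random set $\mathcal K\subset E\times\Omega$ such that $\mathcal K(\omega)$ is compact for $\mathbb P$-almost all $\omega$ and $\mathcal K$ attracts $\mathcal B$, i.e. $$\lim_{t\to\infty} d\bigl(\varphi(t,\vartheta_{-t}\omega)B(\vartheta_{-t}\omega),\mathcal K(\omega)\bigr)=0\qquad \mathbb P\text{-a.s.}$$ (and therefore $\Omega_B(\omega)\subset\mathcal K(\omega)$ a.s.) for every $B\in\mathcal B$. Then $(\varphi,\vartheta)$ has at least one random pullback attractor for $\mathcal B$. (ii) If $(\varphi,\vartheta)$ has at least one random pullback attractor for $\mathcal B$, then it has a minimal random pullback attractor $A$ for $\mathcal B$. In addition, there is a countable sub-family $\mathcal B_0\subset\mathcal B$ such that $A$ is also the minimal random pullback attractor for $\mathcal B_0$. (iii) If $\mathcal K$ is as in the hypothesis of (i), then the minimal random pullback attractor $A$ for $\mathcal B$ satisfies $A(\omega)\subset\mathcal K(\omega)$ for $\mathbb P$-almost all $\omega$.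
   Context: Setting. $E$ is a Polish space with Borel $\sigma$-algebra $\mathcal E$; $d$ is a complete metric generating its topology. For $x\in E$, $A\subset E$: $d(x,A)=\inf\{d(x,a):a\in A\}$, $d(x,\emptyset)=\infty$. For non-empty $A,B\subset E$, $d(B,A):=\sup\{d(b,A):b\in B\}$ (Hausdorff semi-metric); $d(\emptyset,A):=0$, and $d(B,\emptyset):=\infty$ if $B\ne\emptyset$. $(\Omega,\mathscr F,\mathbb P)$ is a probability space, $\mathbb T_1\in\{\mathbb Z,\mathbb R\}$, and $\vartheta:\mathbb T_1\times\Omega\to\Omega$, $(t,\omega)\mapsto\vartheta_t\omega$, is measurable, each $\vartheta_t$ preserves $\mathbb P$, $\vartheta_{t+s}=\vartheta_t\circ\vartheta_s$ and $\vartheta_0=\mathrm{id}$. Let $\mathbb T_2\in\{\mathbb R,[0,\infty),\mathbb Z,\mathbb N_0\}$ with $\mathbb T_2\subseteq\mathbb T_1$. An RDS is a measurable map $\varphi:\mathbb T_2\times E\times\Omega\to E$, $(t,x,\omega)\mapsto\varphi(t,\omega)x$, such that for all $\omega\in\Omega$: $\varphi(t,\omega):E\to E$ is continuous for every $t\in\mathbb T_2$; $\varphi(t+s,\omega)=\varphi(t,\vartheta_s\omega)\circ\varphi(s,\omega)$ for all $s,t\in\mathbb T_2$; $\varphi(0,\omega)=\mathrm{id}$. (No continuity in $t$ is assumed.) Times $t$ in limits, unions and invariance conditions range over $\mathbb T_2$. For $C\subset E\times\Omega$ put $C(\omega)=\{x:(x,\omega)\in C\}$. A random set is an element of $\mathcal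 E\otimes\mathscr F$. A closed (resp. compact) random set is a set $C\subset E\times\Omega$ all of whose sections $C(\omega)$ are closed (resp. compact) and for which $\omega\mapsto d(x,C(\omega))\in[0,\infty]$ is measurable for every $x\in E$ (such a set is a random set). A property depending on $\omega$ holds almost surely if there is a measurable set of full measure on which it holds. For $B\subset E\times\Omega$, $\Omega_B(\omega)=\bigcap_{T\ge0}\overline{\bigcup_{t\ge T}\varphi(t,\vartheta_{-t}\omega)(B(\vartheta_{-t}\omega))}$. A random pullback attractor for $\mathcal B$ is a set $A\subset E\times\Omega$ such that: $A$ is a compact random set; $A$ is strictly invariant, i.e. for every $t\in\mathbb T_2$, $t\ge0$, $\varphi(t,\omega)A(\omega)=A(\vartheta_t\omega)$ $\mathbb P$-a.s.; and for every $B\in\mathcal B$, $\lim_{t\to\infty}d(\varphi(t,\vartheta_{-t}\omega)B(\vartheta_{-t}\omega),A(\omega))=0$ $\mathbb P$-a.s. It is minimal (in the sense of smallest) if $A(\omega)\subset A'(\omega)$ almost surely for every random pullback attractor $A'$ for $\mathcal B$. *)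

(* Defs.v *)
From HB Require Import structures.
From mathcomp Require Import all_boot all_order all_algebra.
From mathcomp Require Import all_classical all_reals all_analysis.
From mathcomp Require Import measurable_realfun.

Set Implicit Arguments.
Unset Strict Implicit.
Unset Printing Implicit Defensive.

Import Order.TTheory GRing.Theory Num.Theory.
Import numFieldNormedType.Exports.

Local Open Scope classical_set_scope.
Local Open Scope ring_scope.

(* A Polish space together with a fixed complete metric [mdist] generating its
   topology.  [Complete] and all measurable types of the library are pointed,
   so these spaces are nonempty. *)
HB.mixin Record isSeparable T & Topological T := {
  separable : exists2 D : set T, countable D & dense D
}.

#[short(type="polishType")]
HB.structure Definition Polish (R : realType) :=
  {T of Metric R T & Complete T & isSeparable T}.

Notation borel E := (g_sigma_algebraType (@open E)).

Section Distances.
Context {R : realType} {E : polishType R}.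
Local Open Scope ereal_scope.

(* [+oo] when [A] is empty *)
Definition dist_pt_set (x : E) (A : set E) : \bar R :=
  ereal_inf [set (mdist x a)%:E | a in A].

(* The case distinction is needed because the supremum of the empty set in
   [\bar R] is [-oo]. *)
Definition hausdorff_semidist (B A : set E) : \bar R :=
  if B == set0 then 0 else ereal_sup [set dist_pt_set b A | b in B].

End Distances.

(* All time sets are represented as subsets of the real line; on the integers
   the trace of the Borel sigma-algebra is the discrete one. *)
Section TimeSets.
Variable R : realType.

Definition int_times : set R := range (fun k : int => k%:~R).
Definition nat_times : set R := range (fun k : nat => k%:R).
Definition nonneg_times : set R := [set t | 0 <= t].

Definition base_time_set (T1 : set R) : Prop :=
  T1 = int_times \/ T1 = setT.

Definition rds_time_set (T1 T2 : set R) : Prop :=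
  [\/ T2 = setT, T2 = nonneg_times, T2 = int_times | T2 = nat_times] /\
  T2 `<=` T1.

(* [measurable_fun D f] has the measurability of [D] as a premise; the
   following lemmas show that this premise holds for the time sets. *)
Lemma measurable_int_times : measurable int_times.
Proof.
apply: countable_measurable => [t|]; first exact: measurable_set1.
by apply: sub_countable (card_image_le _ _) _; exact: countableP.
Qed.

Lemma measurable_nat_times : measurable nat_times.
Proof.
apply: countable_measurable => [t|]; first exact: measurable_set1.
by apply: sub_countable (card_image_le _ _) _; exact: countableP.
Qed.

Lemma measurable_base_time_set (T1 : set R) :
  base_time_set T1 -> measurable T1.
Proof.
by case=> ->; [exact: measurable_int_times|exact: measurableT].
Qed.

Lemma measurable_rds_time_set (T1 T2 : set R) :
  rds_time_set T1 T2 -> measurable T2.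
Proof.
case=> -[] -> _; [exact: measurableT| |exact: measurable_int_times
  |exact: measurable_nat_times].
have -> : nonneg_times = [set` `[0, +oo[%R] by rewrite set_itvE.
exact: measurable_itv.
Qed.

End TimeSets.

Section RandomDynamicalSystems.
Context {R : realType} {E : polishType R} {d : measure_display}
  {Omega : measurableType d}.
Variables (P : probability Omega R) (T1 T2 : set R).

Record metric_dynamical_system (theta : R -> Omega -> Omega) : Prop := {
  mds_measurable :
    measurable_fun (T1 `*` setT) (fun z : R * Omega => theta z.1 z.2);
  mds_preserving : forall t, T1 t ->
    forall F : set Omega, measurable F -> P (theta t @^-1` F) = P F;
  mds_flow : forall s t, T1 s -> T1 t -> theta (t + s) = theta t \o theta s;
  mds_id : theta 0 = id
}.

Record random_dynamical_system (theta : R -> Omega -> Omega)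
    (phi : R -> Omega -> E -> E) : Prop := {
  rds_base : metric_dynamical_system theta;
  rds_measurable :
    measurable_fun (T2 `*` setT `*` setT)
      (fun z : R * borel E * Omega => phi z.1.1 z.2 z.1.2 : borel E);
  rds_continuous : forall t w, T2 t -> continuous (phi t w);
  rds_cocycle : forall s t w, T2 s -> T2 t ->
    phi (t + s) w = phi t (theta s w) \o phi s w;
  rds_id : forall w, phi 0 w = id
}.

Definition random_set (C : set (E * Omega)) : Prop :=
  measurable (C : set (borel E * Omega)).

Definition compact_random_set (C : set (E * Omega)) : Prop :=
  (forall w, compact (ysection C w)) /\
  (forall x : E, measurable_fun setT (fun w => dist_pt_set x (ysection C w))).

Variables (theta : R -> Omega -> Omega) (phi : R -> Omega -> E -> E).

Definition pullback (B : set (E * Omega)) (t : R) (w : Omega) : set E :=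
  phi t (theta (- t) w) @` ysection B (theta (- t) w).

Definition omega_limit (B : set (E * Omega)) (w : Omega) : set E :=
  \bigcap_(T in [set T : R | 0 <= T])
    closure (\bigcup_(t in [set t | T2 t /\ T <= t]) pullback B t w).

Definition attracts (C B : set (E * Omega)) : Prop :=
  {ae P, forall w,
    hausdorff_semidist (pullback B t w) (ysection C w)
      @[t --> within T2 (pinfty_nbhs R)] --> 0%E}.

Definition strictly_invariant (A : set (E * Omega)) : Prop :=
  forall t, T2 t -> 0 <= t ->
    {ae P, forall w, phi t w @` ysection A w = ysection A (theta t w)}.

Definition random_pullback_attractor (BB : set (set (E * Omega)))
    (A : set (E * Omega)) : Prop :=
  [/\ compact_random_set A, strictly_invariant A &
      forall B, BB B -> attracts A B].

Definition minimal_random_pullback_attractor (BB : set (set (E * Omega)))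
    (A : set (E * Omega)) : Prop :=
  random_pullback_attractor BB A /\
  forall A', random_pullback_attractor BB A' ->
    {ae P, forall w, ysection A w `<=` ysection A' w}.

Definition attracting_random_set (BB : set (set (E * Omega)))
    (K : set (E * Omega)) : Prop :=
  [/\ random_set K, {ae P, forall w, compact (ysection K w)} &
      forall B, BB B -> attracts K B].

End RandomDynamicalSystems.

(* Main.v *)
Require Import Defs.
From HB Require Import structures.
From mathcomp Require Import all_boot all_order all_algebra.
From mathcomp Require Import all_classical all_reals all_analysis.
From mathcomp Require Import measurable_realfun.
From mathcomp Require Import lra.
Import Order.TTheory GRing.Theory Num.Theory.
Import numFieldNormedType.Exports.
Local Open Scope classical_set_scope.
Local Open Scope ring_scope.

Set Implicit Arguments.
Unset Strict Implicit.
Unset Printing Implicit Defensive.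

(** Call a compact random set a carrier of the family BB if it almost surely
    contains the omega-limit set of every B in BB.  A compact set that attracts
    B at w contains the omega-limit set of B at w; conversely, once some compact
    set attracts B at w, every set containing the omega-limit set attracts B.
    So, as soon as BB is attracted by almost surely compact sets, the attractors
    are exactly the strictly invariant carriers, and minimality turns into an
    order-theoretic question about carriers.

    Least carriers exist ([exists_least_carrier]) because carriers are stable
    under countable intersection: one intersects countably many carriers so that
    the probabilities of hitting each ball of a countable base are all minimal at
    once; two nested compact random sets with the same hitting probabilities
    agree almost surely.  Applying the same exhaustion to the least carriers of
    the countable subfamilies, now maximising, gives a countable subfamily with
    the same least carrier as BB ([least_carrier_countable]).

    A least carrier A is automatically strictly invariant
    ([least_carrier_attractor]).  The omega-limit sets satisfy
    phi(t,w) Omega_B(w) = Omega_B(theta_t w) on a set of full measure, so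
    phi(t,theta_{-t}w) A(theta_{-t}w) and
    A(w) intersected with the preimage of A(theta_t w) under phi(t,w)
    are again carriers; both contain A by leastness, which is the two
    inclusions of invariance.

    The sets B are arbitrary, so the measurability of omega-limit sets is never
    available; only the carriers are measurable.  Their measurability is handled
    through the events that they hit a given open set ([weakly_measurable]),
    which is equivalent to the measurability of the distance functions.

    The remaining difficulty is that the attracting set K is only measurable in
    the product, so the distance to its sections need not be measurable.  The
    measurable projection theorem ([measurable_projection]), proved with Souslin
    schemes and a capacity argument, shows that the events of hitting a ball
    agree with measurable events up to null sets; discarding countably many null
    sets replaces K by a compact random set ([compact_version]), which is a
    carrier.  This gives existence and, by leastness, the inclusion of the
    minimal attractor in K. *)

(** * Dense sequences and the metric *)

Section Polish.
Context {R : realType} {E : polishType R}.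

Lemma exists_dense_seq :
  exists q : nat -> E, forall x (e : R), 0 < e -> exists n, mdist x (q n) < e.
Proof.
have [D cD dD] := @separable R E.
have ne x (e : R) : 0 < e -> exists2 y, D y & mdist x y < e.
  move=> e0; have [|y [xy Dy]] := dD (ball x e)° _ (@open_interior _ _).
    by exists x; apply: nbhsx_ballx.
  exists y => //; move: (interior_subset xy).
  by rewrite ballEmdist.
have /pfcard_geP[D0|[f]] := cD.
  by have [y] := ne point 1 ltr01; rewrite D0.
exists f => x e /(ne x)[y Dy xy].
by have [n _ fn] := @surj _ _ _ _ f y Dy; exists n; rewrite fn.
Qed.

End Polish.

Section Metric.
Context {R : realType} {E : metricType R}.

Lemma near_mdist (y : E) (e : R) : 0 < e -> \forall z \near y, mdist y z < e.
Proof. by move=> e0; have := nbhsx_ballx y e e0; rewrite ballEmdist. Qed.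

Lemma continuous_mdist (x : E) : continuous (mdist x : E -> R).
Proof.
move=> y; apply/(@cvgrPdist_lt _ R^o) => e e0; near=> z.
have yz : mdist y z < e.
  by near: z; exact: near_mdist.
have := metric_triangle x y z; have := metric_triangle x z y.
rewrite (metric_sym z y) => h1 h2.
by rewrite ltr_distlC; apply/andP; split; lra.
Unshelve. all: by end_near. Qed.

End Metric.

(** * Weakly measurable set-valued maps *)

Definition dense_seq {R : realType} {E : metricType R} (q : nat -> E) :=
  forall x (e : R), 0 < e -> exists n, mdist x (q n) < e.

(** As q runs over a dense sequence these balls form a countable base. *)
Definition basic_ball {R : realType} {E : metricType R} (q : nat -> E) (i : nat * nat) : set E :=
  [set a | mdist (q i.1) a < i.2.+1%:R^-1].

(** Effros measurability of a set-valued map. *)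
Definition weakly_measurable {R : realType} {E : metricType R} {d}
    {Omega : measurableType d} (C : Omega -> set E) :=
  forall U, open U -> measurable [set w | C w `&` U !=set0].

Section WeakMeasurability.
Context {R : realType} {E : metricType R} {d : measure_display}
  {Omega : measurableType d}.
Implicit Types (C : Omega -> set E) (q : nat -> E) (g h : Omega -> E -> R).

Lemma ex_natSinv_lt (e : R) : 0 < e -> exists n : nat, n.+1%:R^-1 < e.
Proof.
move=> e0; have [n _ /(_ n (leqnn n))/= ne] := near_infty_natSinv_lt (PosNum e0).
by exists n.
Qed.

Lemma near_natSinv_lt (e : R) : 0 < e -> \forall n \near \oo, n.+1%:R^-1 < e.
Proof. by move=> e0; exact: near_infty_natSinv_lt (PosNum e0). Qed.

Lemma basic_ball_base q (U : set E) (a : E) : dense_seq q -> open U -> U a ->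
  exists2 i, basic_ball q i a & basic_ball q i `<=` U.
Proof.
move=> qd oU Ua; have /nbhs_ballP[e /= e0] := open_nbhs_nbhs (conj oU Ua).
rewrite ballEmdist => eU.
have [n ne] := @ex_natSinv_lt (e / 2) ltac:(by rewrite divr_gt0).
have [j qj] := qd a n.+1%:R^-1 ltac:(by rewrite invr_gt0).
exists (j, n); first by rewrite /basic_ball/= metric_sym.
move=> b; rewrite /basic_ball/= => qb; apply: eU => /=.
have tri := metric_triangle a (q j) b; move: (n.+1%:R^-1) ne qj qb tri => z ne qj qb tri; lra.
Qed.

Lemma open_basic_ball q i : open (basic_ball q i).
Proof.
rewrite openE => a; rewrite /basic_ball/= => qa.
apply/nbhs_ballP; exists (i.2.+1%:R^-1 - mdist (q i.1) a); rewrite /= ?subr_gt0//.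
rewrite ballEmdist => b /= ab; move: ab.
have := metric_triangle (q i.1) a b; move: (i.2.+1%:R^-1) qa => z; lra.
Qed.

Lemma weakly_measurable_basic q C : dense_seq q ->
  (forall i, measurable [set w | C w `&` basic_ball q i !=set0]) ->
  weakly_measurable C.
Proof.
move=> qd mC U oU.
rewrite (_ : [set _ | _] = \bigcup_(i in [set i | basic_ball q i `<=` U])
   [set w | C w `&` basic_ball q i !=set0]).
  rewrite bigcup_mkcond; apply: countable_bigcupT_measurable => // i.
  by case: ifPn.
apply/seteqP; split => [w /= [a [Ca Ua]]|w /= [i iU [a [Ca ia]]]].
  by have [i ia iU] := basic_ball_base qd oU Ua; exists i => //; exists a.
by exists a; split => //; exact: iU.
Qed.

Lemma measurable_fun_ltP (f : Omega -> R) :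
  measurable_fun setT f <-> forall c, measurable [set w | f w < c].
Proof.
split => [mf c|mf].
  rewrite (_ : [set _ | _] = setT `&` f @^-1` `]-oo, c[%classic).
    exact: mf.
  by apply/seteqP; split => w /=; rewrite in_itv/= => //; case.
apply: (measurability _ (RGenInftyO.measurableE R)) => _ [_ [c ->] <-].
rewrite (_ : _ `&` _ = [set w | f w < c])//.
by apply/seteqP; split => w /=; rewrite in_itv/= => //; case.
Qed.

Lemma measurable_le_of_fun (f : Omega -> R) c :
  measurable_fun setT f -> measurable [set w | f w <= c].
Proof.
move=> mf; rewrite -[X in measurable X]setTI.
exact: (@measurable_fun_ler _ _ _ _ _ (cst c) mf).
Qed.
End WeakMeasurability.

Section Caratheodory.
Context {R : realType} {E : metricType R} {d : measure_display}
  {Omega : measurableType d}.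
Implicit Types (C : Omega -> set E) (q : nat -> E) (g h : Omega -> E -> R).

(** If g w a < r with a in C w, then by continuity g w stays below r - 1/(m+1)
    on a basic ball meeting C w, and this can be tested on the dense sequence;
    so the event is a countable combination of measurable ones.  No measurable
    selection of points of C is involved. *)
Lemma measurable_exists_lt q C g : dense_seq q -> weakly_measurable C ->
  (forall w, continuous (g w)) -> (forall x, measurable_fun setT (g ^~ x)) ->
  forall r, measurable [set w | exists2 a, C w a & g w a < r].
Proof.
move=> qd mC cg mg r.
pose S (k : (nat * nat) * nat) := [set w | C w `&` basic_ball q k.1 !=set0] `&`
  \bigcap_(n in [set n | basic_ball q k.1 (q n)])
    [set w | g w (q n) <= r - k.2.+1%:R^-1].
rewrite (_ : [set _ | _] = \bigcup_k S k); last first.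
  apply/seteqP; split => [w /= [a Ca ga]|w [[i m] _ [/= [a [Ca ia]] gr]]].
    have [m rm] := @ex_natSinv_lt _ (r - g w a) ltac:(by rewrite subr_gt0).
    have oV : open [set b | g w b < r - m.+1%:R^-1].
      rewrite -[X in open X]/(g w @^-1` [set z | z < r - m.+1%:R^-1]).
      by apply: open_comp => [z _|]; [exact: cg|exact: open_lt].
    have [|i ia iV] := basic_ball_base qd oV (a := a).
      by rewrite /=; move: (m.+1%:R^-1) rm => z; lra.
    exists (i, m) => //; split; first by exists a.
    by move=> n /= /iV/= /ltW.
  exists a => //; suff : g w a <= r - m.+1%:R^-1.
    by move=> /le_lt_trans; apply; rewrite ltrBlDr ltrDl invr_gt0.
  rewrite leNgt; apply/negP => ga.
  have oV : open [set b | r - m.+1%:R^-1 < g w b].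
    rewrite -[X in open X]/(g w @^-1` [set z | r - m.+1%:R^-1 < z]).
    by apply: open_comp => [z _|]; [exact: cg|exact: open_gt].
  have oW := openI oV (@open_basic_ball _ _ q i).
  have [n Wn] : exists n, ([set b | r - m.+1%:R^-1 < g w b] `&` basic_ball q i) (q n).
    have /nbhs_ballP[e /= e0] := open_nbhs_nbhs (conj oW (conj ga ia)).
    by rewrite ballEmdist => eW; have [n qn] := qd a e e0; exists n; exact: eW.
  have := gr n Wn.2; have := Wn.1 => /=; rewrite ltNge => /negP; exact.
apply: countable_bigcupT_measurable => // k.
apply: measurableI; first exact: mC _ (@open_basic_ball _ _ q k.1).
apply: bigcap_measurableType => n _; exact: measurable_le_of_fun.
Qed.

Lemma ultra_near_compact (U : set_system nat) (K : set E) (x : nat -> E) :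
  UltraFilter U -> compact K ->
  (forall e, 0 < e -> U [set n | exists2 c, K c & mdist (x n) c < e]) ->
  exists2 y, K y & x @ U --> y.
Proof.
move=> UU cK xK.
(* The points of K close to x n for some n in a set of the ultrafilter. *)
pose N (p : set nat * R) := [set c | K c /\ exists2 n, p.1 n & mdist (x n) c < p.2].
pose D : set (set nat * R) := [set p | U p.1 /\ 0 < p.2].
have FN : ProperFilter (filter_from D N).
  apply: filter_from_proper; last first.
    move=> [V e] [/= UV e0]; have [n [Vn [c Kc xc]]] := filter_ex (filterI UV (xK e e0)).
    by exists c; split => //; exists n.
  apply: filter_from_filter; first by exists (setT, 1); split => //; exact: filterT.
  move=> [V e] [W f] [/= UV e0] [/= UW f0].
  exists (V `&` W, Num.min e f).
    by split => /=; [exact: filterI|rewrite lt_min e0].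
  move=> c [Kc [n [Vn Wn]]] /=; rewrite lt_min => /andP[ce cf].
  by split; split => //; exists n.
have [|y [Ky yN]] := cK _ FN.
  by exists (setT, 1); [split => //; exact: filterT|move=> c []].
exists y => //; apply/metricType_numDomainType.cvgrPdist_lt => e e0.
have [//|Uc] := in_ultra_setVsetC [set n | mdist y (x n) < e] UU.
have e20 : 0 < e / 2 by rewrite divr_gt0.
have [||c [[Kc [n /= nc xc]]]] := yN (N (~` [set n | mdist y (x n) < e], e / 2)) (ball y (e / 2)).
- by exists (~` [set n | mdist y (x n) < e], e / 2).
- exact: nbhsx_ballx.
rewrite ballEmdist /= => yc; case: nc.
have := metric_triangle y c (x n); rewrite (metric_sym c); lra.
Qed.

(** Limits along an ultrafilter finer than the cofinite filter take the place of
    the extraction of subsequences. *)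
Lemma ultra_oo : exists U : set_system nat, UltraFilter U /\ \oo `<=` U.
Proof. exact: ultraFilterLemma. Qed.

(** By compactness, a zero of h in C w exists inside an open ball of radius r as
    soon as, for some k, there are points of C w on which h is arbitrarily small
    and whose distance to the centre exceeds r - 1/(k+1) arbitrarily little; such
    approximate zeros are covered by [measurable_exists_lt]. *)
Lemma weakly_measurable_zeros q C h : dense_seq q -> weakly_measurable C ->
  (forall w, compact (C w)) ->
  (forall w, continuous (h w)) -> (forall x, measurable_fun setT (h ^~ x)) ->
  (forall w x, 0 <= h w x) ->
  weakly_measurable (fun w => C w `&` [set a | h w a = 0]).
Proof.
move=> qd mC cC ch mh h0; apply: (weakly_measurable_basic qd) => -[j m].
pose r : R := m.+1%:R^-1.
pose g k w a := Num.max (mdist (q j) a - (r - k.+1%:R^-1)) (h w a) : R.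
rewrite (_ : [set _ | _] = \bigcup_k \bigcap_n
    [set w | exists2 a, C w a & g k w a < n.+1%:R^-1]); last first.
  apply/seteqP; split => [w /= [a [[Ca ha] ja]]|w [k _ /= gk]].
    have [k rk] := @ex_natSinv_lt _ (r - mdist (q j) a) ltac:(by rewrite subr_gt0).
    exists k => // n _ /=; exists a => //; rewrite /g ha gt_max invr_gt0 ltr0n andbT.
    rewrite (@lt_trans _ _ 0)// ?invr_gt0//; move: rk; move: (k.+1%:R^-1) => z; lra.
  have /choice[a /all_and2[Ca ga]] : forall n, exists a, C w a /\ g k w a < n.+1%:R^-1.
    by move=> n; have [a] := gk n Logic.I; exists a.
  have [U [UU oU]] := ultra_oo.
  have [|y Cy ay] := @ultra_near_compact U (C w) a UU (cC w).
    by move=> e e0; apply: filterS filterT => n _; exists (a n) => //; rewrite mdistxx.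
  have small f : 0 < f -> \forall n \near U, g k w (a n) < f.
    move=> f0; apply: filterS (oU _ (near_natSinv_lt f0)) => n /=.
    exact/lt_trans/ga.
  exists y; split; first split => //.
    apply/eqP; rewrite eq_le h0 andbT leNgt; apply/negP => hy.
    have hay : h w (a n) @[n --> U] --> h w y by apply: cvg_comp ay _; exact: ch.
    have h2 : 0 < h w y / 2 by rewrite divr_gt0.
    have : \forall n \near U, h w y / 2 < h w (a n).
      by apply: (cvgr_gt (h w y)) => //; rewrite ltr_pdivrMr// ltr_pMr// ltr1n.
    move=> /(filterI (small _ h2))/filter_ex[n [/= + h3]].
    by rewrite /g gt_max => /andP[_]; rewrite ltNge (ltW h3).
  rewrite /basic_ball/= -/r.
  have : \forall n \near U, mdist y (a n) < k.+1%:R^-1 / 2.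
    by apply: metricType_numDomainType.cvgr_dist_lt ay _ _; rewrite divr_gt0// invr_gt0.
  have k2 : 0 < (k.+1%:R^-1 / 2 : R) by rewrite divr_gt0// invr_gt0.
  move=> /(filterI (small _ k2))/filter_ex[n [/= + yn]].
  rewrite /g gt_max => /andP[+ _]; have := metric_triangle (q j) (a n) y.
  by rewrite (metric_sym (a n)); move: (k.+1%:R^-1) yn k2 => z; lra.
apply: bigcupT_measurable => k; apply: bigcapT_measurable => n.
have cq : continuous (fun x => mdist (q j) x - (r - k.+1%:R^-1) : R).
  move=> x; apply: cvgB; [exact: continuous_mdist|exact: cvg_cst].
apply: (@measurable_exists_lt q) => //.
  by move=> w x; exact: (@continuous_max R E _ (h w) x (@cq x) (@ch w x)).
move=> x; apply: measurable_maxr => //; exact: measurable_cst.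
Qed.
End Caratheodory.

(** * Intersections and images of random sets *)

Section TruncatedDistance.
Context {R : realType} {E : metricType R}.
Implicit Types (A : set E) (x y : E).

(** The distance to A capped at 1: it stays finite when A is empty, is 1-Lipschitz,
    and vanishes exactly on the closure of A. *)
Definition trunc_dist A x : R := inf [set z | z = 1 \/ exists2 a, A a & z = mdist x a].

Let trunc_dist_lb A x : lbound [set z : R | z = 1 \/ exists2 a, A a & z = mdist x a] 0.
Proof. by move=> z [->//|[a _ ->]]; exact: mdist_ge0. Qed.

Lemma trunc_dist_lt A x r :
  trunc_dist A x < r <-> 1 < r \/ exists2 a, A a & mdist x a < r.
Proof.
split => [/inf_lt[|z [->|[a Aa ->]]]|[r1|[a Aa ar]]].
- by exists 1; left.
- by left.
- by right; exists a.
- by apply: le_lt_trans r1; apply: ge_inf; [exists 0; exact: trunc_dist_lb|left].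
- apply: le_lt_trans ar; apply: ge_inf; first by exists 0; exact: trunc_dist_lb.
  by right; exists a.
Qed.

Lemma trunc_dist_ge0 A x : 0 <= trunc_dist A x.
Proof. by apply: lb_le_inf; [exists 1; left|exact: trunc_dist_lb]. Qed.

Lemma trunc_dist_le1 A x : trunc_dist A x <= 1.
Proof. by apply: ge_inf; [exists 0; exact: trunc_dist_lb|left]. Qed.

Lemma trunc_dist_lip A x y : trunc_dist A x <= trunc_dist A y + mdist x y.
Proof.
rewrite leNgt -ltrBrDr; apply/negP => /trunc_dist_lt[|[a Aa ya]].
  by have := trunc_dist_le1 A x; have := mdist_ge0 x y; lra.
suff : trunc_dist A x < trunc_dist A x by rewrite ltxx.
apply/trunc_dist_lt; right; exists a => //.
by have := metric_triangle x y a; lra.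
Qed.

Lemma trunc_dist_eq0 A x : closed A -> trunc_dist A x = 0 <-> A x.
Proof.
move=> cA; split => [A0|Ax]; last first.
  apply/eqP; rewrite eq_le trunc_dist_ge0 andbT; apply/ler_addgt0Pl => e e0.
  by rewrite addr0 ltW//; apply/trunc_dist_lt; right; exists x => //; rewrite mdistxx.
rewrite closure_id in cA; rewrite cA => B /nbhs_ballP[e/= e0].
rewrite ballEmdist => eB; have e10 : 0 < Num.min e 1 by rewrite lt_min e0/=.
have /trunc_dist_lt[|[a Aa]] : trunc_dist A x < Num.min e 1 by rewrite A0.
  by rewrite lt_min ltxx andbF.
by rewrite lt_min => /andP[ae _]; exists a; split => //; exact: eB.
Qed.

Lemma lipschitz_continuous (f : E -> R) :
  (forall x y, f x <= f y + mdist x y) -> continuous f.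
Proof.
move=> fl x; apply/(@cvgrPdist_lt _ R^o) => e e0; near=> z.
have xz : mdist x z < e by near: z; exact: near_mdist.
have := fl x z; have := fl z x; rewrite (metric_sym z x) => h1 h2.
by rewrite ltr_distlC; apply/andP; split; lra.
Unshelve. all: by end_near. Qed.

Lemma continuous_trunc_dist A : continuous (trunc_dist A).
Proof. by apply: lipschitz_continuous => x y; exact: trunc_dist_lip. Qed.

End TruncatedDistance.

Section Operations.
Context {R : realType} {E : metricType R} {d : measure_display}
  {Omega : measurableType d}.
Implicit Types (C : Omega -> set E) (q : nat -> E).

Lemma open_dist_lt (x : E) (r : R) : open [set a | mdist x a < r].
Proof.
rewrite -[X in open X]/(mdist x @^-1` [set z | z < r]).
apply: open_comp => [z _|]; first exact: continuous_mdist.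
exact: open_lt.
Qed.

Lemma measurable_trunc_dist C x : weakly_measurable C ->
  measurable_fun setT (fun w => trunc_dist (C w) x).
Proof.
move=> mC; apply/measurable_fun_ltP => c; have [c1|c1] := ltP 1 c.
  rewrite (_ : [set _ | _] = setT); first exact: measurableT.
  by apply/seteqP; split => w //= _; apply/trunc_dist_lt; left.
rewrite (_ : [set _ | _] = [set w | C w `&` [set a | mdist x a < c] !=set0]).
  exact/mC/open_dist_lt.
apply/seteqP; split => w /=.
  move=> /trunc_dist_lt[|[a Ca xa]]; first by rewrite ltNge c1.
  by exists a.
by move=> [a [Ca xa]]; apply/trunc_dist_lt; right; exists a.
Qed.

(** The intersection is the zero set, within the first set, of the supremum of the
    distances to all of them, which is a 1-Lipschitz function. *)
Lemma weakly_measurable_bigcap q (C : nat -> Omega -> set E) : dense_seq q ->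
  (forall k, weakly_measurable (C k)) -> (forall k w, compact (C k w)) ->
  weakly_measurable (fun w => \bigcap_k C k w).
Proof.
move=> qd mC cC.
pose h w x : R := sup (range (fun k => trunc_dist (C k w) x)).
have ub w x : has_ubound (range (fun k => trunc_dist (C k w) x)).
  by exists 1 => _ [k _ <-]; exact: trunc_dist_le1.
have hle w x c : h w x <= c <-> forall k, trunc_dist (C k w) x <= c.
  split => [hc k|tc]; last first.
    by apply: ge_sup => [|_ [k _ <-]//]; exists (trunc_dist (C 0%N w) x), 0%N.
  by apply: le_trans hc; apply: ub_le_sup => //; exists k.
have clC k w : closed (C k w).
  by apply: compact_closed; [exact: metric_hausdorff|exact: cC].
have h0 w x : 0 <= h w x.
  apply: le_trans (trunc_dist_ge0 (C 0%N w) x) _.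
  by apply: ub_le_sup => //; exists 0%N.
rewrite (_ : (fun w => _) = fun w => C 0%N w `&` [set a | h w a = 0]); last first.
  apply/funext => w; apply/seteqP; split => x /=.
    move=> Cx; split; first exact: Cx.
    apply/eqP; rewrite eq_le h0 andbT; apply/hle => k.
    by rewrite (_ : trunc_dist (C k w) x = 0)//; apply/trunc_dist_eq0; [exact: clC|exact: Cx].
  move=> [_ hx] k _; apply/(@trunc_dist_eq0 _ _ (C k w)).
    exact: clC.
  apply/eqP; rewrite eq_le trunc_dist_ge0 andbT.
  by move: k; apply/hle; rewrite hx.
apply: (weakly_measurable_zeros qd) => //.
  move=> w; apply: lipschitz_continuous => x y; apply/hle => k.
  apply: le_trans (trunc_dist_lip _ _ y) _; rewrite lerD2r.
  by apply: ub_le_sup => //; exists k.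
move=> x; apply/measurable_fun_ltP => c.
rewrite (_ : [set _ | _] = \bigcup_n \bigcap_k [set w | trunc_dist (C k w) x <= c - n.+1%:R^-1]).
  apply: bigcupT_measurable => n; apply: bigcapT_measurable => k.
  exact/measurable_le_of_fun/measurable_trunc_dist.
apply/seteqP; split => w /=.
  move=> hc; have [n nc] := @ex_natSinv_lt _ (c - h w x) ltac:(by rewrite subr_gt0).
  exists n => // k _ /=; apply: (hle w x _).1.
  by move: (n.+1%:R^-1) nc => z; lra.
move=> [n _ cn]; apply: (@le_lt_trans _ _ (c - n.+1%:R^-1)).
  by apply/hle => k; exact: cn.
by rewrite ltrBlDr ltrDl invr_gt0.
Qed.

(** The image meets a ball iff some point of C w is mapped into it, which
    is an event of the kind treated by [measurable_exists_lt]. *)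
Lemma weakly_measurable_image q C (f : Omega -> E -> E) : dense_seq q ->
  weakly_measurable C -> (forall w, continuous (f w)) ->
  (forall x y, measurable_fun setT (fun w => mdist y (f w x) : R)) ->
  weakly_measurable (fun w => f w @` C w).
Proof.
move=> qd mC cf mf; apply: (weakly_measurable_basic qd) => -[j m].
rewrite (_ : [set _ | _] =
    [set w | exists2 a, C w a & mdist (q j) (f w a) < m.+1%:R^-1]).
  apply: (measurable_exists_lt qd) => // w x.
  by apply: cvg_comp; [exact: cf|exact: continuous_mdist].
apply/seteqP; split => w /=.
  by move=> [_ [[a Ca <-] fa]]; exists a.
by move=> [a Ca fa]; exists (f w a); split => //; exists a.
Qed.

End Operations.

Section CompactRandomSets.
Context {R : realType} {E : polishType R} {d : measure_display}
  {Omega : measurableType d}.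

Definition graph (C : Omega -> set E) : set (E * Omega) := [set z | C z.2 z.1].

Lemma ysection_graph C w : ysection (graph C) w = C w.
Proof. by apply/seteqP; split => x; rewrite ysectionE. Qed.

Lemma dist_pt_set_lt (x : E) (A : set E) (r : R) :
  (dist_pt_set x A < r%:E)%E <-> exists2 a, A a & mdist x a < r.
Proof.
split => [/ereal_inf_ltP[_ [a Aa <-]]|[a Aa xa]].
  by rewrite lte_fin => ?; exists a.
by apply/ereal_inf_ltP; exists (mdist x a)%:E; [exists a|rewrite lte_fin].
Qed.

(** The distance from x to a set is less than r iff the set meets the ball of
    radius r around x. *)
Lemma compact_random_setP (A : set (E * Omega)) :
  compact_random_set A <->
  (forall w, compact (ysection A w)) /\ weakly_measurable (ysection A).
Proof.
have hitE x r : [set w | (dist_pt_set x (ysection A w) < r%:E)%E] =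
    [set w | ysection A w `&` [set a | mdist x a < r] !=set0].
  apply/seteqP; split => w /=; first by move=> /dist_pt_set_lt[a ? ?]; exists a.
  by move=> [a [? ?]]; apply/dist_pt_set_lt; exists a.
split => -[cA mA]; split => //.
  have [q qd] := @exists_dense_seq R E.
  apply: (weakly_measurable_basic qd) => -[j m].
  rewrite -hitE -[X in measurable X]setTI.
  exact: emeasurable_fun_infty_o.
move=> x; apply: (measurability _ (ErealGenInftyO.measurableE R)).
move=> _ [_ [c ->] <-].
rewrite (_ : _ `&` _ = [set w | (dist_pt_set x (ysection A w) < c%:E)%E]).
  by rewrite hitE; exact/mA/open_dist_lt.
by apply/seteqP; split => w /=; rewrite in_itv/= => //; case.
Qed.

End CompactRandomSets.

(** * Outer probability *)

Section OuterProbability.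
Context {d : measure_display} {Omega : measurableType d} {R : realType}.
Variable P : probability Omega R.
Implicit Types S F : set Omega.

Lemma probability_fin F : measurable F -> P F = (fine (P F))%:E.
Proof. by move=> mF; rewrite fineK//; exact: fin_num_measure. Qed.

Lemma le_probability F1 F2 : measurable F1 -> measurable F2 -> F1 `<=` F2 ->
  (P F1 <= P F2)%E.
Proof. by move=> m1 m2 F12; rewrite le_measure ?inE. Qed.

(** An optimal measurable cover exists because the infimum of the probabilities of
    covers is attained along a countable intersection. *)
Lemma exists_hull S : exists H, [/\ measurable H, S `<=` H &
  forall F, measurable F -> S `<=` F -> (P H <= P F)%E].
Proof.
pose V := [set P F | F in [set F | measurable F /\ S `<=` F]].
have V1 : V (P setT) by exists setT => //; split => //; exact: measurableT.
have V0 : (0 <= ereal_inf V)%E by apply/ereal_infP => _ [F _ <-]; exact: measure_ge0.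
have Vf : ereal_inf V \is a fin_num.
  rewrite ge0_fin_numE//; apply: le_lt_trans (ereal_inf_lbound V1) _.
  by rewrite probability_setT ltry.
have /choice[F FP] : forall n : nat, exists F, [/\ measurable F, S `<=` F &
    (P F < ereal_inf V + n.+1%:R^-1%:E)%E].
  move=> n; have [//|_ [F [mF SF] <-] Fn] := @lb_ereal_inf_adherent _ _ n.+1%:R^-1 _ Vf.
  by exists F.
exists (\bigcap_n F n); split.
- by apply: bigcapT_measurable => n; have [] := FP n.
- by move=> w Sw n _; have [_ SF _] := FP n; exact: SF.
move=> G mG SG; apply: (@le_trans _ _ (ereal_inf V)); last first.
  by apply: ereal_inf_lbound; exists G.
apply/lee_addgt0Pr => e e0; have [n ne] := ex_natSinv_lt e0.
have [mF SF Fn] := FP n; apply: le_trans (le_probability _ mF _) _.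
- by apply: bigcapT_measurable => k; have [] := FP k.
- exact: bigcap_inf.
by apply: le_trans (ltW Fn) _; rewrite leeD2l// lee_fin ltW.
Qed.

Definition hull S := sval (cid (exists_hull S)).

Lemma measurable_hull S : measurable (hull S).
Proof. by have [] := svalP (cid (exists_hull S)). Qed.

Lemma sub_hull S : S `<=` hull S.
Proof. by have [] := svalP (cid (exists_hull S)). Qed.

Lemma hull_min S F : measurable F -> S `<=` F -> (P (hull S) <= P F)%E.
Proof. by have [_ _] := svalP (cid (exists_hull S)); exact. Qed.

Lemma le_hull S S' : S `<=` S' -> (P (hull S) <= P (hull S'))%E.
Proof.
move=> SS; apply: hull_min; first exact: measurable_hull.
exact: subset_trans SS (@sub_hull _).
Qed.

(** Outer probability is continuous from below on arbitrary increasing sequences: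
    the tail intersections of the hulls still cover, and they are increasing
    measurable sets. *)
Lemma hull_nondecreasing (S : nat -> set Omega) (c : \bar R) :
  (forall n m, (n <= m)%N -> S n `<=` S m) ->
  (c < P (hull (\bigcup_n S n)))%E -> exists n, (c < P (hull (S n)))%E.
Proof.
move=> ndS cS.
pose H n := \bigcap_(m in [set m | (n <= m)%N]) hull (S m).
have mH n : measurable (H n).
  by apply: bigcap_measurableType => m _; exact: measurable_hull.
have SH n : S n `<=` H n.
  by move=> w Sw m /= nm; apply: sub_hull; exact: ndS Sw.
have mUH : measurable (\bigcup_n H n) by exact: bigcupT_measurable.
have ndH : {homo H : n m / (n <= m)%N >-> (n <= m)%O}.
  move=> n m nm; apply/subsetPset => w Hw k /= mk; apply: Hw => /=.
  exact: leq_trans mk.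
have cH : (c < P (\bigcup_n H n))%E.
  apply: lt_le_trans cS _; apply: hull_min => // w [n _ Sn].
  by exists n => //; exact: SH.
have [n Hn] : exists n, (c < P (H n))%E.
  apply/not_existsP => nc.
  have := nondecreasing_cvg_mu (mu := P) mH mUH ndH => /cvg_lim PH.
  move: cH; rewrite -PH// ltNge => /negP; apply; apply: lime_le.
    by apply/cvg_ex; exists (P (\bigcup_n H n)); exact: nondecreasing_cvg_mu.
  by apply: nearW => n; rewrite leNgt; apply/negP/nc.
exists n; apply: lt_le_trans Hn _; apply: le_probability => //.
  exact: measurable_hull.
by apply: bigcap_inf => /=.
Qed.

End OuterProbability.

(** * Souslin schemes and measurable projection *)

Section Souslin.
Context {R : realType} {E : polishType R} {d : measure_display}
  {Omega : measurableType d}.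
Implicit Types (M : set (E * Omega)).

(** The result of the Souslin operation on a scheme of rectangles, closed in E and
    measurable in Omega.  The rectangles need not shrink along a branch: in
    projections, compactness comes from the metric of E. *)
Definition souslin M := exists (F : seq nat -> set E) (G : seq nat -> set Omega),
  [/\ forall s, closed (F s), forall s, measurable (G s) &
      forall z, M z <-> exists sigma : nat -> nat,
        forall n, F (mkseq sigma n) z.1 /\ G (mkseq sigma n) z.2].

Lemma souslin_rectangle (A : set E) (B : set Omega) :
  closed A -> measurable B -> souslin (A `*` B).
Proof.
move=> cA mB; exists (fun=> A), (fun=> B); split => // -[x w]; split => /=.
  by move=> [Ax Bw]; exists (fun=> 0%N).
by move=> [_ /(_ 0%N)[]].
Qed.

(** The first term of the sequence selects the member of the union. *)
Lemma souslin_bigcup (M : nat -> set (E * Omega)) :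
  (forall i, souslin (M i)) -> souslin (\bigcup_i M i).
Proof.
move=> /choice[F /choice[G FG]].
exists (fun s => if s is i :: s' then F i s' else setT),
       (fun s => if s is i :: s' then G i s' else setT).
have mkseq_cons (sigma : nat -> nat) n :
    mkseq sigma n.+1 = sigma 0%N :: mkseq (sigma \o S) n.
  by rewrite /mkseq/= (iotaDl 1 0) -map_comp.
split.
- by move=> [|i s]; [exact: closedT|have [] := FG i].
- by move=> [|i s]; [exact: measurableT|have [] := FG i].
move=> z; split => [[i _ Mi]|[sigma sz]].
  have [_ _ /(_ z)[/(_ Mi)[sigma sz] _]] := FG i.
  exists (fun n => if n is n'.+1 then sigma n' else i) => -[//|n].
  by rewrite mkseq_cons; exact: sz.
exists (sigma 0%N) => //; have [_ _ ->] := FG (sigma 0%N).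
by exists (sigma \o S) => n; have := sz n.+1; rewrite mkseq_cons.
Qed.

(** A sequence for the intersection must code one sequence tau_i for every i.  Its
    n-th term encodes the list of the tau_i (n - i) for i <= n, so that tau_i k
    is read off from the term of index i + k; a prefix of length n then
    determines the prefix of length n - i of tau_i. *)
Lemma souslin_bigcap (M : nat -> set (E * Omega)) :
  (forall i, souslin (M i)) -> souslin (\bigcap_i M i).
Proof.
move=> /choice[F /choice[G FG]].
pose dec n : seq nat := odflt [::] (unpickle n).
pose sub (s : seq nat) i :=
  mkseq (fun k => nth 0%N (dec (nth 0%N s (i + k))) i) (size s - i).
have sub_mkseq sigma i m :
    sub (mkseq sigma (i + m)) i = mkseq (fun k => nth 0%N (dec (sigma (i + k)%N)) i) m.
  rewrite /sub size_mkseq addKn; apply: (@eq_from_nth _ 0%N).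
    by rewrite !size_mkseq.
  by move=> k; rewrite size_mkseq => km; rewrite !nth_mkseq// ltn_add2l.
exists (fun s => \bigcap_i F i (sub s i)), (fun s => \bigcap_i G i (sub s i)).
split.
- by move=> s; apply: closed_bigI => i _; have [] := FG i.
- by move=> s; apply: bigcapT_measurable => i; have [] := FG i.
move=> z; split => [Mz|[sigma sz] i _]; last first.
  have [_ _ ->] := FG i.
  exists (fun k => nth 0%N (dec (sigma (i + k)%N)) i) => m.
  by have [/(_ i Logic.I) + /(_ i Logic.I)] := sz (i + m)%N; rewrite sub_mkseq.
have /choice[tau tauz] : forall i, exists tau : nat -> nat, forall n,
    F i (mkseq tau n) z.1 /\ G i (mkseq tau n) z.2.
  by move=> i; have [_ _ /(_ z)[+ _]] := FG i; apply; exact: Mz.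
pose sigma n := pickle (mkseq (fun i => tau i (n - i)%N) n.+1).
exists sigma => n.
have subE i : sub (mkseq sigma n) i = mkseq (tau i) (n - i).
  rewrite /sub size_mkseq; apply: (@eq_from_nth _ 0%N).
    by rewrite !size_mkseq.
  move=> k; rewrite size_mkseq => km; rewrite !nth_mkseq//; last first.
    by rewrite -ltn_subRL.
  by rewrite /dec/sigma pickleK/= nth_mkseq ?addKn// ltnS leq_addr.
by split => i _; rewrite subE; have [] := tauz i (n - i)%N.
Qed.

(** The sets that are Souslin together with their complement form a sigma-algebra
    containing the cylinders over open sets and over measurable events. *)
Lemma souslin_measurable M :
  measurable (M : set (borel E * Omega)) -> souslin M.
Proof.
pose bi := [set M | souslin M /\ souslin (~` M)].
have bi0 : bi set0.
  split.
    have -> : set0 = set0 `*` setT :> set (E * Omega) by rewrite set0X.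
    by apply: souslin_rectangle; [exact: closed0|exact: measurableT].
  have -> : ~` set0 = setT `*` setT :> set (E * Omega) by rewrite setC0 setXTT.
  by apply: souslin_rectangle; [exact: closedT|exact: measurableT].
have biC A : bi A -> bi (~` A) by move=> [? ?]; split; rewrite ?setCK.
have biU (A : nat -> set (E * Omega)) : (forall n, bi (A n)) -> bi (\bigcup_n A n).
  move=> bA; split; first by apply: souslin_bigcup => n; have [] := bA n.
  by rewrite setC_bigcup; apply: souslin_bigcap => n; have [] := bA n.
suff : @measurable _ (borel E * Omega)%type `<=` bi by move=> h /h[].
apply: smallest_sub; first by split => // A; rewrite setTD; exact: biC.
move=> _ [[A mA <-]|[B mB <-]]; rewrite setTI; last first.
  split.
    rewrite (_ : _ @^-1` _ = setT `*` B).
      by apply: souslin_rectangle => //; exact: closedT.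
    by apply/seteqP; split => z //= [].
  rewrite (_ : ~` _ = setT `*` ~` B).
    by apply: souslin_rectangle; [exact: closedT|exact: measurableC].
  by apply/seteqP; split => z //= [].
suff : <<s @open E >> `<=` [set A | bi (fst @^-1` A)] by exact.
apply: smallest_sub.
  split => /=.
  - by rewrite preimage_set0.
  - by move=> B bB; rewrite setTD preimage_setC; exact: biC.
  - by move=> B bB; rewrite preimage_bigcup; exact: biU.
have rect U : closed U -> souslin (fst @^-1` U).
  move=> cU; rewrite (_ : _ @^-1` _ = U `*` setT).
    by apply: souslin_rectangle => //; exact: measurableT.
  by apply/seteqP; split => z //= [].
move=> U oU /=; split; last by apply: (rect (~` U)); exact: open_closedC.
(* U is exhausted by the closed sets of points at distance >= 1/(n+1) from its
   complement. *)
rewrite (_ : fst @^-1` U =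
    \bigcup_n fst @^-1` [set x | n.+1%:R^-1 <= trunc_dist (~` U) x]).
  apply: souslin_bigcup => n; apply: rect.
  rewrite -[X in closed X]/(trunc_dist (~` U) @^-1` [set r | n.+1%:R^-1 <= r]).
  apply: preimage_closed; first by move=> x _; exact: continuous_trunc_dist.
  exact: closed_ge.
apply/seteqP; split => -[x w] /=.
  move=> Ux; have : 0 < trunc_dist (~` U) x.
    rewrite lt_neqAle trunc_dist_ge0 andbT; apply/eqP => /esym/trunc_dist_eq0.
    by move=> /(_ (open_closedC oU)); exact.
  by move=> /ex_natSinv_lt[n nx]; exists n => //=; exact: ltW.
move=> [n _ /= nx]; apply: contrapT => nUx; move: nx.
rewrite (_ : trunc_dist _ _ = 0) ?leNgt ?invr_gt0 ?ltr0n//.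
by apply/trunc_dist_eq0 => //; exact: open_closedC.
Qed.

End Souslin.

Section Projection.
Context {R : realType} {E : polishType R} {d : measure_display}
  {Omega : measurableType d}.
Variable P : probability Omega R.

(** An ultrafilter decides finite disjunctions. *)
Lemma ultra_bounded_ex (U : set_system nat) (Q : nat -> set nat) (b : nat) :
  UltraFilter U -> U [set n | exists2 i, (i <= b)%N & Q i n] ->
  exists i, U (Q i).
Proof.
move=> UU; elim: b => [|b IH] Ub.
  by exists 0%N; apply: filterS Ub => n [i]; rewrite leqn0 => /eqP ->.
have [|UQ] := in_ultra_setVsetC (Q b.+1) UU; first by exists b.+1.
apply: IH; apply: filterS (filterI Ub UQ) => n [[i ib Qi] nQ].
exists i => //; move: ib; rewrite leq_eqVlt ltnS => /orP[/eqP ib|//].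
by rewrite ib in Qi.
Qed.

Variables (q : nat -> E) (qd : dense_seq q).
Variables (F : seq nat -> set E) (G : seq nat -> set Omega).
Hypotheses (cF : forall s, closed (F s)) (mG : forall s, measurable (G s)).

(** For a fixed bound b k at every k, these conditions define a totally bounded
   set of points x. *)
Let near_q (b k : nat) (x : E) :=
  exists2 i, (i <= b)%N & mdist (q i) x < k.+1%:R^-1.

Let M : set (E * Omega) := [set z | exists sigma : nat -> nat,
  forall n, F (mkseq sigma n) z.1 /\ G (mkseq sigma n) z.2].

Let proj (A : set (E * Omega)) := [set w | exists x, A (x, w)].

(** The part of M witnessed by sequences bounded by the finite list u, and lying
   close to the corresponding finite parts of the dense sequence. *)
Let bounded (u : seq nat) : set (E * Omega) :=
  [set z | (exists2 sigma : nat -> nat,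
      forall i, (i < size u)%N -> (sigma i <= nth 0%N u i)%N &
      forall n, F (mkseq sigma n) z.1 /\ G (mkseq sigma n) z.2) /\
    forall k, (k < size u)%N -> near_q (nth 0%N u k) k z.1].

Let bounded_rcons u : bounded u `<=` \bigcup_m bounded (rcons u m).
Proof.
move=> z [[sigma su sz] uz].
have [j qj] : exists j, mdist z.1 (q j) < (size u).+1%:R^-1.
  by apply: qd; rewrite invr_gt0.
exists (maxn (sigma (size u)) j) => //; split.
  exists sigma => // i; rewrite size_rcons ltnS leq_eqVlt nth_rcons => /orP[/eqP ->|iu].
    by rewrite ltnn eqxx leq_maxl.
  by rewrite iu; exact: su.
move=> k; rewrite size_rcons ltnS leq_eqVlt nth_rcons => /orP[/eqP ->|ku].
  by rewrite ltnn eqxx; exists j; rewrite ?leq_maxr// metric_sym.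
by rewrite ku; exact: uz.
Qed.

Let bounded_le u m m' : (m <= m')%N -> bounded (rcons u m) `<=` bounded (rcons u m').
Proof.
move=> mm z [[sigma su sz] uz].
have le i : (nth 0%N (rcons u m) i <= nth 0%N (rcons u m') i)%N.
  by rewrite !nth_rcons; case: ifP => // _; case: ifP.
split.
  exists sigma => // i; rewrite size_rcons => iu.
  by apply: leq_trans (le i); apply: su; rewrite size_rcons.
move=> k; rewrite size_rcons => ku.
have [|i ib qi] := uz k; first by rewrite size_rcons.
by exists i => //; exact: leq_trans (le k).
Qed.

(** The sets bounded (rcons u m) increase with m and exhaust bounded u, so at every
   stage a bound can be chosen that keeps the outer probability above c. *)
Let exists_bound (c : \bar R) : (c < P (hull P (proj M)))%E ->
  exists b : nat -> nat, forall n, (c < P (hull P (proj (bounded (mkseq b n)))))%E.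
Proof.
move=> cM.
have /choice[f fP] : forall u, exists m, (c < P (hull P (proj (bounded u))))%E ->
    (c < P (hull P (proj (bounded (rcons u m)))))%E.
  move=> u; have [cu|_] := boolP (c < P (hull P (proj (bounded u))))%E; last first.
    by exists 0%N.
  have [||m cm] := @hull_nondecreasing _ _ _ P (fun m => proj (bounded (rcons u m))) c.
  - by move=> m m' mm w [x xw]; exists x; exact: bounded_le xw.
  - apply: lt_le_trans cu _; apply: le_hull => w [x /bounded_rcons[m _ xw]].
    by exists m => //; exists x.
  - by exists m.
pose u n := iter n (fun u => rcons u (f u)) [::].
have uE n : u n = mkseq (fun i => f (u i)) n.
  by elim: n => // n IH; rewrite mkseqS -IH.
exists (fun i => f (u i)) => n; rewrite -uE; elim: n => [|n IH]; last exact: fP.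
apply: lt_le_trans cM _; apply: le_hull => w [x [sigma sz]].
by exists x; split => //; exists sigma.
Qed.

(** The closed and measurable conditions satisfied up to stage n only: unlike the
   projection of bounded, this event is visibly measurable. *)
Let approx (b : nat -> nat) n : set Omega :=
  [set w | exists (s : seq nat) (x : E),
     [/\ size s = n, forall i, (i < n)%N -> (nth 0%N s i <= b i)%N,
         forall k, (k < n)%N -> near_q (b k) k x &
         forall k, (k <= n)%N -> F (take k s) x /\ G (take k s) w]].

Let measurable_approx b n : measurable (approx b n).
Proof.
pose ok s := exists x : E,
     [/\ size s = n, forall i, (i < n)%N -> (nth 0%N s i <= b i)%N,
         forall k, (k < n)%N -> near_q (b k) k x &
         forall k, (k <= n)%N -> F (take k s) x].
rewrite (_ : approx b n =
    \bigcup_(s in ok) \bigcap_(k in [set k | (k <= n)%N]) G (take k s)).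
  rewrite bigcup_mkcond; apply: countable_bigcupT_measurable => // s.
  by case: ifPn => // _; exact: bigcap_measurableType.
apply/seteqP; split => w.
  move=> [s [x [sn sb xq FG]]]; exists s; last by move=> k /= /FG[].
  by exists x; split => // k /FG[].
move=> [s [x [sn sb xq Fs]] Gs]; exists s, x; split => // k kn.
by split; [exact: Fs|exact: Gs].
Qed.

Let bounded_sub_approx b n : proj (bounded (mkseq b n)) `<=` approx b n.
Proof.
move=> w [x [[sigma]]]; rewrite size_mkseq => sb sz xq.
exists (mkseq sigma n), x; split.
- by rewrite size_mkseq.
- by move=> i iN; rewrite nth_mkseq//; have := sb i iN; rewrite nth_mkseq.
- by move=> k kn; have := xq k kn; rewrite nth_mkseq.
move=> k kn; have -> : take k (mkseq sigma n) = mkseq sigma k.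
  by rewrite /mkseq -map_take take_iota (minn_idPl kn).
exact: sz.
Qed.

Let approx_nonincreasing b n m : (n <= m)%N -> approx b m `<=` approx b n.
Proof.
move=> nm w [s [x [sm sb xq FG]]]; exists (take n s), x; split.
- by rewrite size_takel ?sm.
- by move=> i iN; rewrite nth_take//; apply/sb/(leq_trans iN).
- by move=> k kn; apply/xq/(leq_trans kn).
by move=> k kn; rewrite take_takel//; apply/FG/(leq_trans kn).
Qed.

(** This is where completeness of E enters: along an ultrafilter the bounded
   sequences converge, and the points, being confined to a totally bounded set,
   form a Cauchy filter. *)
Let bigcap_approx b : \bigcap_n approx b n `<=` proj M.
Proof.
move=> w aw.
have /choice[s /choice[x sx]] := fun n => aw n Logic.I.
have [U [UU oU]] := ultra_oo.
have Uge k : U [set n | (k <= n)%N] by apply: oU; exact: nbhs_infty_ge.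
have /choice[sigma sigmaP] : forall i, exists v, U [set n | nth 0%N (s n) i = v].
  move=> i; apply: (@ultra_bounded_ex _ _ (b i)).
  apply: filterS (Uge i.+1) => n /= iN; have [_ sb _ _] := sx n.
  by exists (nth 0%N (s n) i) => //; exact: sb.
have Utake k : U [set n | (k <= n)%N /\ take k (s n) = mkseq sigma k].
  elim: k => [|k IH]; first by apply: filterS filterT => n _ /=; rewrite take0.
  apply: filterS (filterI (Uge k.+1) (filterI IH (sigmaP k))) => n /= [kn [[_ tk] sk]].
  split => //; rewrite (take_nth 0%N); last by have [-> _ _ _] := sx n.
  by rewrite tk sk mkseqS.
have cx : cauchy (x @ U).
  apply: cauchy_exP => e e0.
  have [k ke] := ex_natSinv_lt e0.
  have [|i Ui] := @ultra_bounded_ex U (fun i n => mdist (q i) (x n) < k.+1%:R^-1) (b k) UU.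
    by apply: filterS (Uge k.+1) => n /= kn; have [_ _ xq _] := sx n; exact: xq.
  exists (q i); rewrite /= ballEmdist; apply: filterS Ui => n /= qn.
  exact: lt_trans ke.
have /cvg_ex[y xy] : cvg (x @ U) by exact: cauchy_cvg.
exists y, sigma => k; split => /=.
  apply: (closed_cvg _ (@cF (mkseq sigma k)) _ y xy).
  apply: filterS (Utake k) => n /= [kn <-].
  by have [_ _ _ /(_ k kn)[]] := sx n.
have [n [/= kn <-]] := filter_ex (Utake k).
by have [_ _ _ /(_ k kn)[]] := sx n.
Qed.

(** Capacitability: the projection of a Souslin set is approximated from inside, in
    outer probability, by measurable events. *)
Lemma souslin_inner (c : \bar R) : (c < P (hull P (proj M)))%E ->
  exists D, [/\ measurable D, D `<=` proj M & (c <= P D)%E].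
Proof.
move=> /exists_bound[b bP]; exists (\bigcap_n approx b n).
have mcap : measurable (\bigcap_n approx b n).
  by apply: bigcapT_measurable => n; exact: measurable_approx.
split; [exact: mcap|exact: (@bigcap_approx b)|].
have cvgP : (P \o approx b) n @[n --> \oo] --> P (\bigcap_n approx b n).
  apply: nonincreasing_cvg_mu => //.
    by rewrite (le_lt_trans (probability_le1 _ _))// ?ltry.
  by move=> n m nm; apply/subsetPset/approx_nonincreasing.
have /cvg_lim <- // := cvgP; apply: lime_ge.
  by apply/cvg_ex; exists (P (\bigcap_n approx b n)).
apply: nearW => n; apply: le_trans (ltW (bP n)) _.
by apply: hull_min => //; exact: bounded_sub_approx.
Qed.

End Projection.

Section MeasurableProjection.
Context {R : realType} {E : polishType R} {d : measure_display}
  {Omega : measurableType d}.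
Variable P : probability Omega R.

(** Inner approximations of the projection and its measurable hull have the same
    probability. *)
Theorem measurable_projection (M : set (E * Omega)) :
  measurable (M : set (borel E * Omega)) ->
  exists G1 G2, [/\ measurable G1, measurable G2,
    G1 `<=` [set w | ysection M w !=set0],
    [set w | ysection M w !=set0] `<=` G2 & P (G2 `\` G1) = 0%E].
Proof.
move=> /souslin_measurable[F [G [cF mG MFG]]].
have [q qd] := @exists_dense_seq R E.
pose S := [set w | exists x, exists sigma : nat -> nat,
  forall n, F (mkseq sigma n) (x, w).1 /\ G (mkseq sigma n) (x, w).2].
have SE : [set w | ysection M w !=set0] = S.
  apply/seteqP; split => w /= [x].
    by rewrite ysectionE/= => Mx; exists x; exact/(MFG (x, w)).1.
  by move=> Mx; exists x; rewrite ysectionE/=; exact/(MFG (x, w)).2.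
pose h := P (hull P S).
have hf : h = (fine h)%:E by apply: probability_fin; exact: measurable_hull.
have /choice[D DP] : forall n : nat, exists D,
    [/\ measurable D, D `<=` S & ((fine h - n.+1%:R^-1)%:E <= P D)%E].
  move=> n; apply: (souslin_inner qd cF mG).
  by rewrite -/h hf lte_fin ltrBlDr ltrDl invr_gt0.
have mD : measurable (\bigcup_n D n) by apply: bigcupT_measurable => n; have [] := DP n.
have DS : \bigcup_n D n `<=` S by move=> w [n _]; have [_ + _] := DP n; exact.
exists (\bigcup_n D n), (hull P S); rewrite SE; split => //.
- exact: measurable_hull.
- exact: sub_hull.
have mh := measurable_hull P S.
have Dh : \bigcup_n D n `<=` hull P S := subset_trans DS (@sub_hull _ _ _ P S).
rewrite measureD//; last first.
  by rewrite (le_lt_trans (probability_le1 _ _))// ?ltry.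
rewrite (setIidr Dh); suff PD : P (\bigcup_n D n) = P (hull P S).
  by rewrite [X in (_ - X)%E]PD subee//; exact: fin_num_measure.
apply/eqP; rewrite eq_le le_probability//= -/h hf.
apply/lee_addgt0Pr => e e0; have [n ne] := ex_natSinv_lt e0.
have [mDn _ nD] := DP n.
apply: (@le_trans _ _ (P (D n) + e%:E)%E); last first.
  by rewrite leeD2r// le_probability//; exact: bigcup_sup.
apply: (@le_trans _ _ ((fine h - n.+1%:R^-1)%:E + e%:E)%E); last by rewrite leeD2r.
by rewrite -EFinD lee_fin; move: (n.+1%:R^-1) ne => z; lra.
Qed.

End MeasurableProjection.

Section CompactVersion.
Context {R : realType} {E : polishType R} {d : measure_display}
  {Omega : measurableType d}.
Variable P : probability Omega R.

(** The events that K hits the basic balls are measurable up to null sets.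
    Emptying the sections of K over the countable union of these null sets makes
    them measurable. *)
Lemma compact_version (K : set (E * Omega)) :
  random_set K -> {ae P, forall w, compact (ysection K w)} ->
  exists C, compact_random_set C /\
    {ae P, forall w, ysection C w = ysection K w}.
Proof.
move=> mK [N0 [mN0 PN0 KN0]].
have [q qd] := @exists_dense_seq R E.
pose K' i : set (E * Omega) := K `&` fst @^-1` basic_ball q i.
have /choice[G /choice[H GH]] : forall i, exists G1 G2, [/\ measurable G1, measurable G2,
    G1 `<=` [set w | ysection (K' i) w !=set0],
    [set w | ysection (K' i) w !=set0] `<=` G2 & P (G2 `\` G1) = 0%E].
  move=> i; apply: measurable_projection; apply: measurableI => //.
  rewrite -[X in measurable X]setTI.
  have mfst : measurable_fun setT (fst : borel E * Omega -> borel E).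
    exact: measurable_fst.
  apply: (mfst measurableT (basic_ball q i)).
  by apply: sub_sigma_algebra; exact: open_basic_ball.
have K'E i w : ysection (K' i) w = ysection K w `&` basic_ball q i.
  by apply/seteqP; split => x; rewrite !ysectionE/= => -[].
pose N := N0 `|` \bigcup_i (H i `\` G i).
have mHG i : measurable (H i `\` G i).
  by have [mG mH _ _ _] := GH i; exact: measurableD.
have mN : measurable N.
  by apply: measurableU => //; exact: countable_bigcupT_measurable.
have PN : P.-negligible N.
  apply: negligibleU; first exact/negligibleP.
  rewrite (_ : \bigcup_i _ = \bigcup_n
      if unpickle n is Some i then H i `\` G i else set0).
    apply: negligible_bigcup => n; case: unpickle => [i|]; last exact: negligible_set0.
    by apply/negligibleP => //; have [] := GH i.
  apply/seteqP; split => w [i _ iw]; first by exists (pickle i); rewrite ?pickleK.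
  by move: iw; case: unpickle => // j; exists j.
pose C w := [set x | ysection K w x /\ ~ N w].
have CN w : N w -> C w = set0.
  by move=> Nw; rewrite -subset0 => x [].
have CnN w : ~ N w -> C w = ysection K w.
  by move=> nN; apply/seteqP; split => x // [].
exists (graph C); split.
  apply/compact_random_setP; split=> [w|].
    rewrite ysection_graph; have [/CN ->|nN] := pselect (N w).
      exact: compact0.
    by rewrite CnN//; apply: contrapT => nc; apply: nN; left; exact: KN0.
  have -> : ysection (graph C) = C by apply/funext => w; exact: ysection_graph.
  apply: (weakly_measurable_basic qd) => i.
  rewrite (_ : [set _ | _] = H i `\` N).
    by apply: measurableD => //; have [] := GH i.
  have [_ _ GK KH _] := GH i.
  apply/seteqP; split => w /=.
    move=> [x [[Kx nN] ix]]; split => //; apply: KH => /=; exists x.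
    by rewrite K'E.
  move=> [Hw nN]; rewrite CnN// -K'E; apply: GK; apply: contrapT => nG.
  by apply: nN; right; exists i.
apply: negligibleS PN => w /=; rewrite ysection_graph => Cw.
by apply: contrapT => /CnN.
Qed.

End CompactVersion.

(** * Pullback attraction and omega-limit sets *)

Section TimeSetFacts.
Variables (R : realType) (T1 T2 : set R).

Lemma base_time_setD s t : base_time_set T1 -> T1 s -> T1 t -> T1 (s + t).
Proof.
by case=> -> // [i _ <-] [j _ <-]; exists (i + j) => //; rewrite rmorphD.
Qed.

Lemma base_time_setN t : base_time_set T1 -> T1 t -> T1 (- t).
Proof. by case=> -> // [i _ <-]; exists (- i) => //; rewrite rmorphN. Qed.

Lemma rds_time_setD s t : rds_time_set T1 T2 -> T2 s -> T2 t -> T2 (s + t).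
Proof.
case=> -[] -> _ //.
- by rewrite /nonneg_times/= => *; exact: addr_ge0.
- by move=> [i _ <-] [j _ <-]; exists (i + j) => //; rewrite rmorphD.
- by move=> [i _ <-] [j _ <-]; exists (i + j)%N => //; rewrite natrD.
Qed.

Lemma rds_time_setB s t : rds_time_set T1 T2 -> T2 s -> T2 t -> t <= s ->
  T2 (s - t).
Proof.
case=> -[] -> _ //.
- by rewrite /nonneg_times/= subr_ge0.
- by move=> [i _ <-] [j _ <-] _; exists (i - j) => //; rewrite rmorphB.
- by move=> [i _ <-] [j _ <-]; rewrite ler_nat => ij; exists (i - j)%N => //; rewrite natrB.
Qed.

Lemma rds_time_set_sub : rds_time_set T1 T2 -> T2 `<=` T1.
Proof. by case. Qed.
End TimeSetFacts.

Section Pullback.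
Context {R : realType} {E : polishType R} {d : measure_display}
  {Omega : measurableType d}.
Variables (T2 : set R) (theta : R -> Omega -> Omega) (phi : R -> Omega -> E -> E).
Implicit Types (B C : set (E * Omega)) (w : Omega) (K : set E).

(** Pullback attraction of B by K at the single point w, in metric terms. *)
Definition attracts_at K B w := forall e : R, 0 < e -> exists T0, forall t,
  T2 t -> T0 <= t -> forall b, pullback theta phi B t w b ->
  exists2 c, K c & mdist b c < e.

Lemma hausdorff_semidist_ge0 (B A : set E) : (0 <= hausdorff_semidist B A)%E.
Proof.
rewrite /hausdorff_semidist; case: ifPn => // /set0P[b Bb].
apply: (@le_trans _ _ (dist_pt_set b A)); last by apply: ereal_sup_ubound; exists b.
by apply/ereal_infP => _ [a _ <-]; rewrite lee_fin mdist_ge0.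
Qed.

Lemma attracts_atP K B w : attracts_at K B w <->
  hausdorff_semidist (pullback theta phi B t w) K
    @[t --> within T2 (pinfty_nbhs R)] --> 0%E.
Proof.
split=> [KB|cvgK e e0].
  (* The bound e / 2 makes the semi-distance a finite number, hence a real. *)
  move=> A [e /= e0 eA]; have e20 : 0 < e / 2 by rewrite divr_gt0.
  have [T0 T0P] := KB _ e20.
  exists T0; split; first exact: num_real.
  move=> t Tt T2t.
  have h0 := hausdorff_semidist_ge0 (pullback theta phi B t w) K.
  have he : (hausdorff_semidist (pullback theta phi B t w) K <= (e / 2)%:E)%E.
    rewrite /hausdorff_semidist; case: ifPn => _; first by rewrite lee_fin ltW.
    apply: ge_ereal_sup => _ [b Bb <-]; apply/ltW/dist_pt_set_lt.
    exact: T0P (ltW Tt) _ Bb.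
  rewrite /=; move: h0 he; case: hausdorff_semidist => // r.
  rewrite !lee_fin => r0 re; apply: eA; rewrite /ball/= sub0r normrN ger0_norm//.
  lra.
have := cvgK [set x | (x < e%:E)%E].
have: nbhs 0%E [set x : \bar R | (x < e%:E)%E] by apply: open_ereal_lt'; rewrite lte_fin.
move=> nb /(_ nb)[M [_ MP]].
exists (M + 1) => t T2t Mt b Bb; apply/dist_pt_set_lt.
have := MP t; rewrite (lt_le_trans _ Mt) ?ltrDl// => /(_ isT T2t) /=.
rewrite /hausdorff_semidist; case: ifPn => [/eqP B0|_].
  by move: Bb; rewrite B0.
by apply: le_lt_trans; apply: ereal_sup_ubound; exists b.
Qed.

Lemma omega_limitP B w y : omega_limit T2 theta phi B w y <->
  forall T e : R, 0 < e -> exists t, [/\ T2 t, T <= t &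
    exists2 b, pullback theta phi B t w b & mdist y b < e].
Proof.
split=> [By T e e0|By T /= T0].
  have T0 : 0 <= Num.max 0 T by rewrite le_max lexx.
  have [|b [[t [T2t Tt] Bb]]] := By _ T0 (ball y e); first exact: nbhsx_ballx.
  rewrite ballEmdist /= => yb; exists t; split => //; last by exists b.
  by apply: le_trans Tt; rewrite le_max lexx orbT.
move=> A /nbhs_ballP[e /= e0]; rewrite ballEmdist => eA.
have [t [T2t Tt [b Bb yb]]] := By T e e0.
by exists b; split; [exists t|exact: eA].
Qed.

Lemma omega_limit_sub K B w : closed K -> attracts_at K B w ->
  omega_limit T2 theta phi B w `<=` K.
Proof.
move=> cK KB y /omega_limitP By; rewrite closure_id in cK; rewrite cK.
move=> A /nbhs_ballP[e /= e0]; rewrite ballEmdist => eA.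
have e20 : 0 < e / 2 by rewrite divr_gt0.
have [T0 T0P] := KB _ e20; have [t [T2t Tt [b Bb yb]]] := By T0 _ e20.
have [c Kc bc] := T0P t T2t Tt b Bb; exists c; split => //; apply: eA => /=.
have := metric_triangle y b c; lra.
Qed.

(** Points taken from pullbacks at times tending to infinity come close to the
    compact set K, so they accumulate, and their limits are in the omega-limit
    set. *)
Lemma omega_limit_accumulation K B w (U : set_system nat) (t : nat -> R) (x : nat -> E) :
  UltraFilter U -> \oo `<=` U -> compact K -> attracts_at K B w ->
  (forall n, T2 (t n)) -> (forall M : R, \forall n \near \oo, M <= t n) ->
  (forall n, pullback theta phi B (t n) w (x n)) ->
  exists2 y, omega_limit T2 theta phi B w y & x @ U --> y.
Proof.
move=> UU oU cK KB T2t t_oo Bx.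
have [|y Ky xy] := @ultra_near_compact R E U K x UU cK.
  move=> e e0; have [T0 T0P] := KB _ e0.
  by apply: oU; apply: filterS (t_oo T0) => n T0n; exact: T0P (Bx n).
exists y => //; apply/omega_limitP => T e e0.
have [n [/= Tn yn]] := filter_ex (filterI (oU _ (t_oo T))
  (metricType_numDomainType.cvgr_dist_lt xy e0)).
by exists (t n); split => //; exists (x n).
Qed.

(** Otherwise there would be points of pullbacks at arbitrarily late times that
    stay at distance at least e from A; their limit lies in the omega-limit set,
    hence in A. *)
Lemma omega_limit_attracts K A B w : compact K -> attracts_at K B w ->
  omega_limit T2 theta phi B w `<=` A -> attracts_at A B w.
Proof.
move=> cK KB BA e e0; apply/not_existsP => nT.
have /choice[t /choice[x tx]] : forall n : nat, exists t b, [/\ T2 t, n%:R <= t,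
    pullback theta phi B t w b & ~ exists2 c, A c & mdist b c < e].
  move=> n; have /existsNP[t /not_implyP[T2t /not_implyP[nt]]] := nT n%:R.
  by move=> /existsNP[b /not_implyP[Bb nb]]; exists t, b.
have [U [UU oU]] := ultra_oo.
have [|M|n|y yB xy] := @omega_limit_accumulation K B w U t x UU oU cK KB.
- by move=> n; have [] := tx n.
- apply: filterS (nbhs_infty_ger M) => n Mn; have [_ + _ _] := tx n.
  exact: le_trans.
- by have [] := tx n.
have [n yn] := filter_ex (metricType_numDomainType.cvgr_dist_lt xy e0).
by have [_ _ _] := tx n; apply; exists y; [exact: BA|rewrite metric_sym].
Qed.

Section Invariance.
Variables (P : probability Omega R) (T1 : set R).
Hypotheses (hT1 : base_time_set T1) (hT2 : rds_time_set T1 T2)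
  (hphi : random_dynamical_system P T1 T2 theta phi).

Lemma theta_thetaN s w : T1 s -> theta s (theta (- s) w) = w.
Proof.
move=> T1s; have [_ _ flow id0] := rds_base hphi.
have := flow (- s) s (base_time_setN hT1 T1s) T1s.
by rewrite subrr id0 => /(congr1 (@^~ w)).
Qed.

(** The cocycle property, read along the orbit of w. *)
Lemma pullback_shift B s t w : T2 s -> T2 t ->
  pullback theta phi B (s + t) (theta t w) = phi t w @` pullback theta phi B s w.
Proof.
move=> T2s T2t; have [_ _ flow _] := rds_base hphi.
have [T1s T1t] := (rds_time_set_sub hT2 T2s, rds_time_set_sub hT2 T2t).
have back : theta (- (s + t)) (theta t w) = theta (- s) w.
  rewrite -[LHS]/((theta (- (s + t)) \o theta t) w) -flow//; last first.
    by apply: (base_time_setN hT1); exact: (base_time_setD hT1).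
  by rewrite opprD subrK.
rewrite /pullback back addrC (rds_cocycle hphi _ T2s T2t) theta_thetaN//.
by rewrite image_comp.
Qed.

Lemma omega_limit_forward B t w : T2 t -> 0 <= t ->
  phi t w @` omega_limit T2 theta phi B w `<=`
  omega_limit T2 theta phi B (theta t w).
Proof.
move=> T2t t0 _ [y /omega_limitP By <-]; apply/omega_limitP => T e e0.
have [D /= D0 De] : exists2 D : R, 0 < D &
    forall z, mdist y z < D -> mdist (phi t w y) (phi t w z) < e.
  have cphi : continuous (phi t w) by exact: (rds_continuous hphi).
  have := cphi y _ (nbhsx_ballx _ _ e0).
  by move=> /nbhs_ballP[D /= D0]; rewrite !ballEmdist => DP; exists D.
have [s [T2s Ts [b Bb yb]]] := By T D D0.
exists (s + t); split.
- exact: rds_time_setD hT2 T2s T2t.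
- by rewrite (le_trans Ts)// lerDl.
by exists (phi t w b); [rewrite pullback_shift//; exists b|exact: De].
Qed.

(** A point z of the limit set at theta t w is a limit of points phi t w (x n) with
    x n in pullbacks at w; compactness makes the x n converge. *)
Lemma omega_limit_backward K B t w : T2 t -> compact K -> attracts_at K B w ->
  omega_limit T2 theta phi B (theta t w) `<=`
  phi t w @` omega_limit T2 theta phi B w.
Proof.
move=> T2t cK KB z /omega_limitP Bz.
(* Times are requested beyond t + n so that t can be subtracted from them. *)
have /choice[s /choice[x sx]] : forall n : nat, exists s b, [/\ T2 s, n%:R <= s,
    pullback theta phi B s w b & mdist z (phi t w b) < n.+1%:R^-1].
  move=> n; have [|s [T2s ns [b0 + zb]]] := Bz (t + n%:R) n.+1%:R^-1.
    by rewrite invr_gt0.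
  have ts : t <= s by apply: le_trans ns; rewrite lerDl.
  have T2st := rds_time_setB hT2 T2s T2t ts.
  rewrite -{1}(subrK t s) pullback_shift// => -[b Bb b0E]; rewrite -b0E in zb.
  by exists (s - t), b; split => //; rewrite lerBrDl.
have [U [UU oU]] := ultra_oo.
have [|M|n|y yB xy] := @omega_limit_accumulation K B w U s x UU oU cK KB.
- by move=> n; have [] := sx n.
- apply: filterS (nbhs_infty_ger M) => n Mn; have [_ + _ _] := sx n.
  exact: le_trans.
- by have [] := sx n.
exists y => //.
have fxy : phi t w (x n) @[n --> U] --> phi t w y.
  by apply: cvg_comp xy _; exact: (rds_continuous hphi).
apply: (cvg_unique (@metric_hausdorff _ E) fxy).
apply/metricType_numDomainType.cvgrPdist_lt => e e0.
apply: filterS (oU _ (near_natSinv_lt e0)) => n /=.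
by have [_ _ _] := sx n; exact: lt_trans.
Qed.

End Invariance.
End Pullback.

(** * Exhaustion by hitting probabilities *)

(** Exhaustion: a sequence in S that approaches all the infima, one index of I and
    one accuracy at a time, is dominated by a single element of S, which then
    attains all of them. *)
Lemma exists_common_minimum (R : realType) (X : Type) (I : countType)
    (S : set X) (f : I -> X -> R) (m : R) :
  S !=set0 -> (forall i x, S x -> m <= f i x) ->
  (forall u : nat -> X, (forall n, S (u n)) ->
    exists2 x, S x & forall i n, f i x <= f i (u n)) ->
  exists2 x, S x & forall y, S y -> forall i, f i x <= f i y.
Proof.
move=> [x0 Sx0] fm dirS.
have /choice[u uP] : forall ik : I * nat, exists x, S x /\
    forall y, S y -> f ik.1 x < f ik.1 y + ik.2.+1%:R^-1.
  move=> [i k]; pose V := [set f i x | x in S].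
  have hV : has_inf V.
    by split; [exists (f i x0), x0|exists m => _ [x Sx <-]; exact: fm].
  have [|_ [x Sx <-] xk] := @inf_adherent _ V k.+1%:R^-1 _ hV.
    by rewrite invr_gt0.
  exists x; split => // y Sy; apply: lt_le_trans xk _; rewrite lerD2r.
  by apply: ge_inf; [exact: hV.2|exists y].
pose v n := if unpickle n is Some ik then u ik else x0.
have [|x Sx xv] := dirS v.
  by move=> n; rewrite /v; case: unpickle => // ik; have [] := uP ik.
exists x => // y Sy i; apply/ler_addgt0Pr => e e0.
have [k ke] := ex_natSinv_lt e0; have [_ /(_ y Sy)/= uk] := uP (i, k).
have := xv i (pickle (i, k)); rewrite /v pickleK => xu.
by apply: (le_trans xu); apply: (le_trans (ltW uk)); rewrite lerD2l ltW.
Qed.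

Section HittingProbabilities.
Context {R : realType} {E : polishType R} {d : measure_display}
  {Omega : measurableType d}.
Variables (P : probability Omega R) (q : nat -> E).
Hypothesis qd : dense_seq q.
Implicit Types A : set (E * Omega).

Definition hit A i := [set w | ysection A w `&` basic_ball q i !=set0].

Lemma measurable_hit A i : compact_random_set A -> measurable (hit A i).
Proof. by move=> /compact_random_setP[_]; apply; exact: open_basic_ball. Qed.

Lemma ae_le_hit A A' i : compact_random_set A -> compact_random_set A' ->
  {ae P, forall w, ysection A w `<=` ysection A' w} ->
  P (hit A i `\` hit A' i) = 0%E.
Proof.
move=> cA cA' AA'; apply: measure_negligible.
  by apply: measurableD; exact: measurable_hit.
apply: negligibleS AA' => w /= [[x [Ax ix]] nA'] AA'.
by apply: nA'; exists x; split => //; exact: AA'.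
Qed.

Lemma ae_le_prob_hit A A' i : compact_random_set A -> compact_random_set A' ->
  {ae P, forall w, ysection A w `<=` ysection A' w} ->
  (P (hit A i) <= P (hit A' i))%E.
Proof.
move=> cA cA' AA'.
have [mA mA'] := (measurable_hit i cA, measurable_hit i cA').
apply: (@le_trans _ _ (P (hit A' i `|` (hit A i `\` hit A' i)))).
  apply: le_probability => //.
    by apply: measurableU => //; exact: measurableD.
  by move=> w Aw; have [|] := pselect (hit A' i w); [left|right].
have := measureU2 P mA' (measurableD mA mA').
move=> /le_trans; apply; rewrite -[leRHS]adde0 leeD2l//.
by rewrite [leLHS](ae_le_hit i cA cA' AA').
Qed.

(** Equal probabilities force the nested hitting events to agree almost surely for
    all basic balls; a closed set is determined by the basic balls that it hits. *)
Lemma ae_eq_of_prob_hit A A' : compact_random_set A -> compact_random_set A' ->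
  {ae P, forall w, ysection A w `<=` ysection A' w} ->
  (forall i, (P (hit A' i) <= P (hit A i))%E) ->
  {ae P, forall w, ysection A' w `<=` ysection A w}.
Proof.
move=> cA cA' AA' le_hit.
have null i : P.-negligible (hit A' i `\` hit A i).
  have [mA mA'] := (measurable_hit i cA, measurable_hit i cA').
  apply/negligibleP; first exact: measurableD.
  have hI : P (hit A' i `&` hit A i) = P (hit A i).
    have := measureDI P mA mA'; rewrite [X in (X + _)%E](ae_le_hit i cA cA' AA').
    by rewrite add0e setIC => ->.
  rewrite measureD//; last by rewrite (le_lt_trans (probability_le1 _ _))// ?ltry.
  have PA' : P (hit A' i) = P (hit A i).
    by apply/eqP; rewrite eq_le le_hit ae_le_prob_hit.
  by rewrite [X in (_ - X)%E]hI [X in (X - _)%E]PA' subee// fin_num_measure.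
have /negligible_bigcup N : forall n : nat, P.-negligible
    (if unpickle n is Some i then hit A' i `\` hit A i else set0).
  move=> n; case: unpickle => [i|]; first exact: null.
  exact: negligible_set0.
apply: negligibleS N => w /= /existsNP[x /not_implyP[A'x nAx]].
have /compact_random_setP[/(_ w) cAw _] := cA.
have clA : closed (ysection A w) by apply: compact_closed => //; exact: metric_hausdorff.
have [i ix iA] := basic_ball_base qd (closed_openC clA) nAx.
exists (pickle i) => //; rewrite pickleK; split; first by exists x.
by move=> [y [Ay /iA]].
Qed.

End HittingProbabilities.

(** * Carriers of the omega-limit sets *)

Section Carriers.
Context {R : realType} {E : polishType R} {d : measure_display}
  {Omega : measurableType d}.
Variables (P : probability Omega R) (T2 : set R)
  (theta : R -> Omega -> Omega) (phi : R -> Omega -> E -> E).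
Implicit Types (A : set (E * Omega)) (BB : set (set (E * Omega))).

Definition carrier BB A := compact_random_set A /\
  forall B, BB B ->
    {ae P, forall w, omega_limit T2 theta phi B w `<=` ysection A w}.

Definition least_carrier BB A := carrier BB A /\
  forall A', carrier BB A' -> {ae P, forall w, ysection A w `<=` ysection A' w}.

Lemma carrier_sub BB BB' A : BB' `<=` BB -> carrier BB A -> carrier BB' A.
Proof. by move=> sBB [cA BA]; split => // B /sBB; exact: BA. Qed.

Lemma ae_sub_trans (C1 C2 C3 : Omega -> set E) :
  {ae P, forall w, C1 w `<=` C2 w} -> {ae P, forall w, C2 w `<=` C3 w} ->
  {ae P, forall w, C1 w `<=` C3 w}.
Proof. by apply: filterS2 => w; exact: subset_trans. Qed.

Lemma carrier_of_attracting BB A : compact_random_set A ->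
  (forall B, BB B -> attracts P T2 theta phi A B) -> carrier BB A.
Proof.
move=> cA AB; split => // B /AB; rewrite /attracts; apply: filterS => w Aw.
apply: omega_limit_sub; last by apply/attracts_atP; exact: Aw.
apply: (compact_closed (@metric_hausdorff _ E)).
by have /compact_random_setP[] := cA.
Qed.

Lemma carrier_bigcap BB (A : nat -> set (E * Omega)) :
  (forall n, carrier BB (A n)) -> carrier BB (\bigcap_n A n).
Proof.
move=> cA; have [q qd] := @exists_dense_seq R E.
have cA' n w : compact (ysection (A n) w).
  by have [/compact_random_setP[]] := cA n.
have AE w : ysection (\bigcap_n A n) w = \bigcap_n ysection (A n) w.
  apply/seteqP; split => x; rewrite ysectionE => Ax n _.
    by rewrite ysectionE; exact: Ax.
  by have := Ax n Logic.I; rewrite ysectionE.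
split.
  apply/compact_random_setP; split=> [w|].
    rewrite AE; apply: (subclosed_compact _ (cA' 0%N w)); last exact: bigcap_inf.
    by apply: closed_bigI => n _; apply: (compact_closed (@metric_hausdorff _ E)).
  have -> : ysection (\bigcap_n A n) = fun w => \bigcap_n ysection (A n) w.
    exact/funext.
  apply: (weakly_measurable_bigcap (C := fun n => ysection (A n)) qd) => // n.
  by have [/compact_random_setP[]] := cA n.
move=> B BBB.
have : {ae P, forall w, forall n,
    omega_limit T2 theta phi B w `<=` ysection (A n) w}.
  by apply: ae_foralln => n; have [_ /(_ B BBB)] := cA n.
apply: filterS => w Bw x Bx; rewrite ysectionE => n _.
by have := Bw n x Bx; rewrite ysectionE.
Qed.

Let prob_hit q A i : R := fine (P (hit q A i)).

Let le_prob_hit q A A' i : compact_random_set A -> compact_random_set A' ->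
  (prob_hit q A i <= prob_hit q A' i) = (P (hit q A i) <= P (hit q A' i))%E.
Proof.
move=> cA cA'; rewrite /prob_hit.
by rewrite [in RHS]probability_fin 1?[in X in (_ <= X)%E]probability_fin ?lee_fin//;
  exact: measurable_hit.
Qed.

(** A carrier A with minimal hitting probabilities is least: for another carrier A',
    the intersection of A and A' is a carrier inside A whose hitting probabilities
    are no smaller. *)
Lemma exists_least_carrier BB : (exists A, carrier BB A) -> exists A, least_carrier BB A.
Proof.
move=> [A0 cA0]; have [q qd] := @exists_dense_seq R E.
have [| | |A cA Amin] := @exists_common_minimum R _ (nat * nat)%type (carrier BB)
    (fun i A => prob_hit q A i) 0.
- by exists A0.
- by move=> i A _; apply: fine_ge0; exact: measure_ge0.
- move=> u cu; exists (\bigcap_n u n); first exact: carrier_bigcap.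
  move=> i n; rewrite le_prob_hit; [|exact: (carrier_bigcap cu).1|exact: (cu n).1].
  apply: ae_le_prob_hit; [exact: (carrier_bigcap cu).1|exact: (cu n).1|].
  apply: aeW => w x; rewrite !ysectionE; exact.
exists A; split => // A' cA'.
pose u n := if n is 0%N then A else A'.
have cu n : carrier BB (u n) by case: n.
have cI := carrier_bigcap cu.
have : {ae P, forall w, ysection A w `<=` ysection (\bigcap_n u n) w}.
  apply: (ae_eq_of_prob_hit qd cI.1 cA.1).
    by apply: aeW => w x; rewrite !ysectionE; exact: (@bigcap_inf _ _ 0%N).
  by move=> i; rewrite -le_prob_hit ?Amin//; [exact: cA.1|exact: cI.1].
apply: filterS => w AI x /AI; rewrite !ysectionE.
exact: (@bigcap_inf _ _ 1%N).
Qed.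

(** Larger subfamilies have larger least carriers.  Among the countable ones choose
    a subfamily BB0 whose least carrier A has maximal hitting probabilities;
    adjoining any further B to BB0 cannot enlarge A. *)
Lemma least_carrier_countable BB : (exists A, carrier BB A) ->
  exists A, exists BB0, [/\ countable BB0, BB0 `<=` BB,
    least_carrier BB0 A & least_carrier BB A].
Proof.
move=> [A0 cA0]; have [q qd] := @exists_dense_seq R E.
pose S := [set A | exists BB0, [/\ countable BB0, BB0 `<=` BB & least_carrier BB0 A]].
have least BB0 : BB0 `<=` BB -> exists A, least_carrier BB0 A.
  by move=> sBB; apply: exists_least_carrier; exists A0; exact: carrier_sub cA0.
have [| | |A [BB0 [cBB0 sBB0 lA]] Amax] :=
    @exists_common_minimum R _ (nat * nat)%type S (fun i A => - prob_hit q A i) (-1).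
- have [A lA] := least set0 (@sub0set _ _).
  by exists A, set0; split => //; exact: countable0.
- move=> i A [BBA [_ _ lA]]; rewrite lerN2 /prob_hit.
  have mA := measurable_hit q i lA.1.1.
  by rewrite -lee_fin -probability_fin//; exact: probability_le1.
- move=> u /choice[BBu uP].
  have [|x lx] := least (\bigcup_n BBu n).
    by move=> B [n _]; have [_ + _] := uP n; exact.
  exists x.
    exists (\bigcup_n BBu n); split => //.
      by apply: bigcup_countable => // n _; have [] := uP n.
    by move=> B [n _]; have [_ + _] := uP n; exact.
  move=> i n; have [_ _ lu] := uP n.
  rewrite lerN2 le_prob_hit; [|exact: lu.1.1|exact: lx.1.1].
  apply: ae_le_prob_hit; [exact: lu.1.1|exact: lx.1.1|].
  by apply: lu.2; apply: carrier_sub lx.1; exact: bigcup_sup.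
exists A, BB0; split => //; split; last first.
  by move=> A' cA'; apply: lA.2; exact: carrier_sub cA'.
split; first exact: lA.1.1.
move=> B BBB.
have [|AB lAB] := least (B |` BB0).
  by move=> B' [->|/sBB0].
have AAB : {ae P, forall w, ysection A w `<=` ysection AB w}.
  by apply: lA.2; apply: carrier_sub lAB.1; exact: subsetUr.
apply: (ae_sub_trans (C2 := ysection AB)); first by apply: lAB.1.2; left.
apply: (ae_eq_of_prob_hit qd lA.1.1 lAB.1.1 AAB) => i.
rewrite -le_prob_hit; [|exact: lAB.1.1|exact: lA.1.1].
rewrite -lerN2; apply: Amax; exists (B |` BB0); split => //.
  rewrite -bigcup2E; apply: bigcup_countable => [|[|[|n]] _].
  - exact: countableP.
  - exact: countable1.
  - exact: cBB0.
  - exact: countable0.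
by move=> B' [->|/sBB0].
Qed.

End Carriers.

(** * Invariance of least carriers *)

Section LeastCarrierAttractor.
Context {R : realType} {E : polishType R} {d : measure_display}
  {Omega : measurableType d}.
Variables (P : probability Omega R) (T1 T2 : set R)
  (theta : R -> Omega -> Omega) (phi : R -> Omega -> E -> E).
Hypotheses (hT1 : base_time_set T1) (hT2 : rds_time_set T1 T2)
  (hphi : random_dynamical_system P T1 T2 theta phi).
Implicit Types (A K : set (E * Omega)) (BB : set (set (E * Omega))).

Let T2T1 t : T2 t -> T1 t. Proof. exact: (rds_time_set_sub hT2). Qed.

Let T1N t : T1 t -> T1 (- t). Proof. exact: (base_time_setN hT1). Qed.

Lemma measurable_theta t : T1 t -> measurable_fun setT (theta t).
Proof.
move=> T1t; have [mth _ _ _] := rds_base hphi.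
apply: (@measurable_comp _ _ _ _ _ _ (T1 `*` setT) (fun z => theta z.1 z.2) setT (pair t)).
- by apply: measurableX; [exact: measurable_base_time_set|exact: measurableT].
- by move=> _ [w _ <-].
- exact: mth.
- by apply/measurable_fun_pairP; split; [exact: measurable_cst|exact: measurable_id].
Qed.

(** The flow preserves P, hence null sets. *)
Lemma ae_theta t (Q : Omega -> Prop) : T1 t ->
  {ae P, forall w, Q w} -> {ae P, forall w, Q (theta t w)}.
Proof.
move=> T1t [N [mN PN NQ]]; exists (theta t @^-1` N); split.
- by rewrite -[X in measurable X]setTI; exact: measurable_theta.
- by have [_ pres _ _] := rds_base hphi; rewrite pres.
- by move=> w /= nQ; apply: NQ.
Qed.

Lemma measurable_phi t x (U : set E) : T2 t -> open U ->
  measurable [set w | U (phi t w x)].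
Proof.
move=> T2t oU.
have mphi := rds_measurable hphi.
have : measurable_fun setT (fun w => phi t w x : borel E).
  apply: (@measurable_comp _ _ _ _ _ _ (T2 `*` setT `*` setT)
    (fun z : R * borel E * Omega => phi z.1.1 z.2 z.1.2 : borel E) setT
    (fun w => ((t, x : borel E), w))).
  - apply: measurableX; last exact: measurableT.
    apply: measurableX; last exact: measurableT.
    exact: measurable_rds_time_set hT2.
  - by move=> _ [w _ <-].
  - exact: mphi.
  - by apply/measurable_fun_pairP; split; [exact: measurable_cst|exact: measurable_id].
move=> /(_ measurableT U); rewrite setTI; apply.
exact: sub_sigma_algebra.
Qed.

Lemma measurable_mdist_phi t x y : T2 t ->
  measurable_fun setT (fun w => mdist y (phi t w x) : R).
Proof.
move=> T2t; apply/measurable_fun_ltP => c.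
exact: (@measurable_phi t x _ T2t (open_dist_lt y c)).
Qed.

Lemma weakly_measurable_theta t (C : Omega -> set E) : T1 t ->
  weakly_measurable C -> weakly_measurable (fun w => C (theta t w)).
Proof.
move=> T1t mC U /mC mCU; rewrite -[X in measurable X]setTI.
exact: (measurable_theta T1t measurableT mCU).
Qed.

Let theta_thetaN' s w : T1 s -> theta (- s) (theta s w) = w.
Proof.
move=> T1s; have := theta_thetaN hT1 hphi w (T1N T1s).
by rewrite opprK.
Qed.

(** Backward invariance of the omega-limit sets transfers to carriers; the
    attracting set K provides the compactness that it requires. *)
Lemma carrier_image BB K A t : T2 t ->
  {ae P, forall w, compact (ysection K w)} ->
  (forall B, BB B -> attracts P T2 theta phi K B) ->
  carrier P T2 theta phi BB A ->
  carrier P T2 theta phi BB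
    (graph (fun w => phi t (theta (- t) w) @` ysection A (theta (- t) w))).
Proof.
move=> T2t cK KB [/compact_random_setP[cA mA] AB].
have [q qd] := @exists_dense_seq R E.
split.
  apply/compact_random_setP; split=> [w|].
    rewrite ysection_graph; apply: continuous_compact; last exact: cA.
    by apply: continuous_subspaceT; exact: (rds_continuous hphi).
  have -> : ysection (graph (fun w => phi t (theta (- t) w) @` ysection A (theta (- t) w)))
      = fun w => phi t (theta (- t) w) @` ysection A (theta (- t) w).
    by apply/funext => w; exact: ysection_graph.
  apply: (weakly_measurable_theta (T1N (T2T1 T2t)) (C := fun w => phi t w @` ysection A w)).
  apply: (weakly_measurable_image qd) => //.
    by move=> w; exact: (rds_continuous hphi).
  by move=> x y; exact: measurable_mdist_phi.
move=> B BBB; have T1t := T1N (T2T1 T2t).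
have h := ae_theta T1t cK.
have h' := ae_theta T1t (KB B BBB).
have h'' := ae_theta T1t (AB B BBB).
move: h h' h''; apply: filterS3 => w; rewrite ysection_graph.
set v := theta (- t) w => cKv KBv ABv.
have -> : w = theta t v by rewrite /v (theta_thetaN hT1 hphi)//; exact: T2T1.
apply: (subset_trans (omega_limit_backward hT1 hT2 hphi T2t cKv _)).
  by apply/attracts_atP; exact: KBv.
exact: image_subset.
Qed.

(** Forward invariance of the omega-limit sets transfers to carriers.  Membership
    in the closed section at theta t w is the vanishing of a distance, so
    [weakly_measurable_zeros] gives the measurability. *)
Lemma carrier_preimage BB A t : T2 t -> 0 <= t ->
  carrier P T2 theta phi BB A ->
  carrier P T2 theta phi BB
    (graph (fun w => ysection A w `&`
      [set x | ysection A (theta t w) (phi t w x)])).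
Proof.
move=> T2t t0 [/compact_random_setP[cA mA] AB].
have [q qd] := @exists_dense_seq R E.
have clA w : closed (ysection A w).
  by apply: (compact_closed (@metric_hausdorff _ E)); exact: cA.
pose h w x : R := trunc_dist (ysection A (theta t w)) (phi t w x).
have hE w : ysection A w `&` [set x | ysection A (theta t w) (phi t w x)] =
    ysection A w `&` [set x | h w x = 0].
  by apply/seteqP; split => x /= [Ax] /trunc_dist_eq0; move=> /(_ (clA _)).
have ch w : continuous (h w).
  move=> x; apply: cvg_comp; last exact: continuous_trunc_dist.
  exact: (rds_continuous hphi).
split.
  apply/compact_random_setP; split=> [w|].
    rewrite ysection_graph hE; apply: (subclosed_compact _ (cA w)) => [|x []//].
    apply: closedI => //.
    rewrite -[X in closed X]/(h w @^-1` [set 0]).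
    by apply: preimage_closed => //; move=> x _; exact: ch.
  rewrite (_ : ysection _ = fun w => ysection A w `&` [set x | h w x = 0]); last first.
    by apply/funext => w; rewrite ysection_graph hE.
  apply: (weakly_measurable_zeros qd) => //; last by move=> w x; exact: trunc_dist_ge0.
  move=> x; apply/measurable_fun_ltP => c; have [c1|c1] := ltP 1 c.
    rewrite (_ : [set _ | _] = setT); first exact: measurableT.
    by apply/seteqP; split => w //= _; apply/trunc_dist_lt; left.
  rewrite (_ : [set _ | _] = [set w | exists2 a, ysection A (theta t w) a &
      mdist a (phi t w x) < c]).
    apply: (@measurable_exists_lt R E _ _ q (fun w => ysection A (theta t w))
      (fun w a => mdist a (phi t w x))) => //.
    - exact: weakly_measurable_theta (T2T1 T2t) mA.
    - move=> w a; rewrite (_ : (fun a => _) = mdist (phi t w x)).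
        exact: continuous_mdist.
      by apply/funext => b; exact: metric_sym.
    - by move=> a; exact: measurable_mdist_phi.
  apply/seteqP; split => w /=.
    move=> /trunc_dist_lt[|[a Aa xa]]; first by rewrite ltNge c1.
    by exists a => //; rewrite metric_sym.
  by move=> [a Aa xa]; apply/trunc_dist_lt; right; exists a => //; rewrite metric_sym.
move=> B BBB.
move: (AB B BBB) (ae_theta (T2T1 T2t) (AB B BBB)).
apply: filterS2 => w Aw Atw.
rewrite ysection_graph => x Bx; split; first exact: Aw.
apply: Atw; apply: (omega_limit_forward hT1 hT2 hphi T2t t0).
by exists x.
Qed.

(** Comparing A with its image gives A(theta_t w) inside phi(t,w) A(w), and
    comparing it with its preimage gives the other inclusion. *)
Lemma least_carrier_attractor BB K A :
  {ae P, forall w, compact (ysection K w)} ->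
  (forall B, BB B -> attracts P T2 theta phi K B) ->
  least_carrier P T2 theta phi BB A ->
  random_pullback_attractor P T2 theta phi BB A.
Proof.
move=> cK KB [cA leA]; split; first exact: cA.1.
  move=> t T2t t0.
  have back := ae_theta (T2T1 T2t) (leA _ (carrier_image T2t cK KB cA)).
  have forw := leA _ (carrier_preimage T2t t0 cA).
  move: back forw; apply: filterS2 => w; rewrite !ysection_graph.
  rewrite theta_thetaN'; last exact: T2T1.
  move=> Ab Af; apply/seteqP; split => // _ [x /Af[_ Ax] <-].
  exact: Ax.
move=> B BBB; rewrite /attracts.
move: cK (KB B BBB) (cA.2 B BBB); apply: filterS3 => w cKw KBw Aw.
apply/attracts_atP; apply: (omega_limit_attracts cKw _ Aw).
by apply/attracts_atP.
Qed.

Lemma attractor_carrier BB A : random_pullback_attractor P T2 theta phi BB A ->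
  carrier P T2 theta phi BB A.
Proof. by move=> [cA _ AB]; exact: carrier_of_attracting. Qed.

Lemma attracting_random_set_version BB K :
  attracting_random_set P T2 theta phi BB K ->
  exists2 C, carrier P T2 theta phi BB C &
    {ae P, forall w, ysection C w = ysection K w}.
Proof.
move=> [mK cK KB]; have [C [cC CK]] := compact_version mK cK.
exists C => //; apply: carrier_of_attracting => // B BBB.
by rewrite /attracts; move: CK (KB B BBB); apply: filterS2 => w ->.
Qed.

End LeastCarrierAttractor.

Theorem theorem13 (R : realType) (E : polishType R)
    (d : measure_display) (Omega : measurableType d)
    (P : probability Omega R) (T1 T2 : set R)
    (theta : R -> Omega -> Omega) (phi : R -> Omega -> E -> E)
    (BB : set (set (E * Omega)))
    (hT1 : base_time_set T1) (hT2 : rds_time_set T1 T2)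
    (hphi : random_dynamical_system P T1 T2 theta phi) :
  [/\ forall K : set (E * Omega),
        attracting_random_set P T2 theta phi BB K ->
        (forall B, BB B ->
          {ae P, forall w, omega_limit T2 theta phi B w `<=` ysection K w}) /\
        (exists A, random_pullback_attractor P T2 theta phi BB A),
      (exists A, random_pullback_attractor P T2 theta phi BB A) ->
      exists A, minimal_random_pullback_attractor P T2 theta phi BB A /\
        exists BB0 : set (set (E * Omega)),
          [/\ countable BB0, BB0 `<=` BB &
              minimal_random_pullback_attractor P T2 theta phi BB0 A] &
      forall K : set (E * Omega),
        attracting_random_set P T2 theta phi BB K ->
        forall A, minimal_random_pullback_attractor P T2 theta phi BB A ->
          {ae P, forall w, ysection A w `<=` ysection K w}].
Proof.
have least_attractor K : attracting_random_set P T2 theta phi BB K ->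
    exists2 A, random_pullback_attractor P T2 theta phi BB A &
      {ae P, forall w, ysection A w `<=` ysection K w}.
  move=> hK; have [mK cK KB] := hK.
  have [C cC CK] := attracting_random_set_version hK.
  have [A lA] : exists A, least_carrier P T2 theta phi BB A.
    by apply: exists_least_carrier; exists C.
  exists A; first exact: (least_carrier_attractor hT1 hT2 hphi cK KB).
  by move: (lA.2 _ cC) CK; apply: filterS2 => w + <-.
split.
- move=> K hK; split; last by have [A] := least_attractor K hK; exists A.
  have [C [_ CB] CK] := attracting_random_set_version hK.
  by move=> B BBB; move: (CB B BBB) CK; apply: filterS2 => w + <-.
- move=> [A0 hA0]; have cA0 := attractor_carrier hA0.
  have [A [BB0 [cBB0 sBB0 lA0 lA]]] := least_carrier_countable (ex_intro _ A0 cA0).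
  have hA : random_pullback_attractor P T2 theta phi BB A.
    have [/compact_random_setP[cptA0 _] _ A0B] := hA0.
    exact: (least_carrier_attractor hT1 hT2 hphi (aeW _ cptA0) A0B).
  exists A; split; first by split => // A' /attractor_carrier; exact: lA.2.
  exists BB0; split => //; split; last by move=> A' /attractor_carrier; exact: lA0.2.
  by have [cptA iA AB] := hA; split => // B /sBB0; exact: AB.
- move=> K /least_attractor[A' hA' A'K] A [_ /(_ A' hA') AA'].
  exact: ae_sub_trans AA' A'K.
Qed.
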